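(* Assume that $p$, $N$, $d$, $c$ satisfy Condition A or Condition B. Let $\varphi_c(z)=z\left(1+\sum_{n=1}^{\infty}a_n z^{-nd}\right)$ and let $\varphi_c^{-1}(z)$ be its compositional inverse, which is a formal series of the form $z\left(1+\sum_{n\ge1}a_n' z^{-nd}\right)$. Then the maximal convergent open disks (around $\infty$) of $\varphi_c(z)$ and of $\varphi_c^{-1}(z)$ are both $$D(\infty,r_N^{1/d})=\{z\in\mathbb{C}_p:|z|_p>r_N^{1/d}\},\qquad r_N=\left(|c/d^{N+1}|_p\,p^{1/(p-1)}\right)^{1/d^N}>1.$$ Moreover, $\varphi_c$ is a bijective isometry from $D(\infty,r_N^{1/d})$ onto itself.
   Context: Let $p$ be a prime, $\mathbb{C}_p$ the completion of an algebraic closure of $\mathbb{Q}_p$, $v_p$ the valuation on $\mathbb{C}_p$ with $v_p(p)=1$, and $|x|_p=p^{-v_p(x)}$. Let $d\ge2$ be an integer and $c\in\mathbb{C}_p$. Let $(a_n)_{n\ge1}$ be the unique sequence in $\mathbb{C}_p$ satisfying the formal power series identity $$\Big(1+\sum_{n\ge1}a_nx^n\Big)^d=1+cx+\sum_{n\ge1}a_nx^{nd}.$$ (Equivalently, with $x=z^{-d}$, $\varphi_c$ satisfies $f_c(\varphi_c(z))=\varphi_c(z^d)$ where $f_c(z)=z^d-c$.) Condition A: $N=0$, $d$ is a multiple of $p$, and $v_p(c)<v_p(d)+\frac{v_p((d-1)!)}{d-1}$. Condition B: $N\ge1$ is an integer, $d$ is a power of $p$, and $Nv_p(d)+\frac{v_p((d-1)!)}{d-1}<v_p(c)<(N+1)v_p(d)+\frac{v_p((d-1)!)}{d-1}$.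 For a series $z\left(1+\sum_n \gamma_n z^{-nd}\right)$, its maximal convergent open disk is the largest set $D(\infty,\rho)=\{|z|_p>\rho\}$ on which it converges, i.e. $\rho^d=\limsup_n|\gamma_n|_p^{1/n}$. *)

(* Defs.v *)
From HB Require Import structures.
From mathcomp Require Import all_boot all_order all_algebra.
From mathcomp Require Import all_classical all_reals all_analysis.
Set Implicit Arguments. Unset Strict Implicit. Unset Printing Implicit Defensive.
Import Order.TTheory GRing.Theory Num.Theory.
Local Open Scope ring_scope.

(* "K with nrm is (an isometric copy of) C_p": an algebraically closed field
   with a non-archimedean absolute value, |p| = 1/p, complete, and in which
   the elements algebraic over Q are dense.  These properties characterise
   C_p up to isometric isomorphism. *)
Definition cauchy_seq (R : realType) (K : fieldType) (nrm : K -> R) (u : nat -> K) :=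
  forall eps : R, 0 < eps -> exists n0 : nat,
    forall m n : nat, (n0 <= m)%N -> (n0 <= n)%N -> nrm (u m - u n) < eps.

Definition converges_to (R : realType) (K : fieldType) (nrm : K -> R)
  (u : nat -> K) (l : K) :=
  forall eps : R, 0 < eps -> exists n0 : nat,
    forall m : nat, (n0 <= m)%N -> nrm (u m - l) < eps.

Definition is_Cp (p : nat) (R : realType) (K : closedFieldType) (nrm : K -> R) :=
  (forall x, 0 <= nrm x) /\ (forall x, nrm x = 0 <-> x = 0) /\
      (forall x y, nrm (x * y) = nrm x * nrm y) /\
      (forall x y, nrm (x + y) <= Num.max (nrm x) (nrm y)) /\
      nrm (p%:R) = (p%:R)^-1 /\
      (forall u, cauchy_seq nrm u -> exists l, converges_to nrm u l) /\
      (forall x (eps : R), 0 < eps -> exists y : K,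
         (exists q : {poly rat}, q != 0 /\ root (map_poly ratr q) y)
         /\ nrm (x - y) < eps).

Definition vpr (p : nat) (R : realType) (K : fieldType) (nrm : K -> R) (x : K) : R :=
  - ln (nrm x) / ln (p%:R).

Definition vp (p : nat) (R : realType) (K : fieldType) (nrm : K -> R) (x : K) : \bar R :=
  if x == 0 then +oo%E else (vpr p nrm x)%:E.

Definition condA (p N d : nat) (R : realType) (K : fieldType) (nrm : K -> R) (c : K) :=
  [/\ N = 0%N, (p %| d)%N &
     (vp p nrm c < (vpr p nrm (d%:R) + vpr p nrm ((d.-1)`!%:R) / (d.-1)%:R)%:E)%E].

Definition condB (p N d : nat) (R : realType) (K : fieldType) (nrm : K -> R) (c : K) :=
  [/\ (1 <= N)%N, (exists k : nat, d = (p ^ k)%N),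
     ((N%:R * vpr p nrm (d%:R) + vpr p nrm ((d.-1)`!%:R) / (d.-1)%:R)%:E < vp p nrm c)%E
   & (vp p nrm c < ((N.+1)%:R * vpr p nrm (d%:R) + vpr p nrm ((d.-1)`!%:R) / (d.-1)%:R)%:E)%E].

(* Formal power series 1 + sum_{n>=1} a_n x^n, handled through truncations:
   coefficient 0 is 1, a 0 is ignored. *)
Definition ser1 (K : fieldType) (a : nat -> K) (n : nat) : K :=
  if n is 0 then 1 else a n.

Definition trunc1 (K : fieldType) (a : nat -> K) (M : nat) : {poly K} :=
  \poly_(i < M.+1) ser1 a i.

(* (1 + sum a_n x^n)^d = 1 + c x + sum a_n x^{nd}, coefficientwise *)
Definition is_phi_seq (d : nat) (K : fieldType) (c : K) (a : nat -> K) :=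
  forall M : nat,
    ((trunc1 a M) ^+ d)`_M =
      (M == 0%N)%:R + (M == 1%N)%:R * c
      + (if (0 < M)%N && (d %| M)%N then a (M %/ d)%N else 0).

(* Given phi(z) = z F(z^{-d}), F = 1 + sum a_n x^n, the series
   psi(z) = z G(z^{-d}), G = 1 + sum a'_n x^n, is its compositional inverse
   iff psi(phi(z)) = z, i.e. (with x = z^{-d}) F(x) * G(x * W(x)) = 1 where
   W = F^{-d}.  All identities are formal, checked on truncations. *)
Definition is_inverse_seq (d : nat) (K : fieldType) (a a' : nat -> K) :=
  exists w : nat -> K,
    (forall M : nat, (trunc1 w M * (trunc1 a M) ^+ d)`_M = (M == 0%N)%:R) /\
    (forall M : nat,
       (((trunc1 a' M) \Po ('X * trunc1 w M)) * trunc1 a M)`_M = (M == 0%N)%:R).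

(* rho^d = limsup |gamma_n|^{1/n}: the d-th power of the radius of the maximal
   convergent disk of z (1 + sum gamma_n z^{-nd}) *)
Definition rad_pow (R : realType) (K : fieldType) (nrm : K -> R) (g : nat -> K) : \bar R :=
  limn_esup (fun n : nat => ((nrm (g n)) `^ ((n%:R)^-1))%:E).

Definition partial_phi (d : nat) (K : fieldType) (g : nat -> K) (z : K) (m : nat) : K :=
  z * (1 + \sum_(1 <= n < m.+1) g n * (z ^+ (n * d)%N)^-1).

Definition r_N (p N d : nat) (R : realType) (K : fieldType) (nrm : K -> R) (c : K) : R :=
  (nrm (c / (d ^ N.+1)%N%:R) * (p%:R `^ ((p.-1)%:R)^-1)) `^ (((d ^ N)%N%:R)^-1).

(* Main.v *)
Require Import Defs.
From HB Require Import structures.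
From mathcomp Require Import all_boot all_order all_algebra.
From mathcomp Require Import all_classical all_reals all_analysis.
From mathcomp Require Import ring lra.
Import Order.TTheory GRing.Theory Num.Theory.
Local Open Scope ring_scope.

(** Write F(x) = 1 + sum a_n x^n, so that F(x)^d = F(x^d) + c x. Iterating,
    F is the product over i >= 0 of the factors
      E_i = (1 + c x^(d^i) / F(x^(d^(i+1))))^(1 / d^(i+1)),
    whose binomial expansion involves only coefficients of F of much lower degree.
    As p divides d, the k-th binomial coefficient of (1 + c X)^(1 / d^(i+1)) has
    absolute value |c / d^(i+1)|^k / |k!|, so that E_i contributes the radius
    r_i = (|c / d^(i+1)| p^(1/(p-1)))^(1/d^i). Conditions A and B imply that
    r_N is the strict maximum of the r_i; hence |a_n| <= r_N^n, and the factor E_N,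
    whose coefficient of degree d^N p^t has absolute value
    p^(-1/(p-1)) r_N^(d^N p^t), forces the growth of the a_n.
    The equation defining the inverse series bounds its coefficients by those of F
    and conversely, so that both series have the same radius. Finally
    |a_n| <= r_N^n makes phi(z) - z a strict contraction, which gives the isometry
    and, by iterating z |-> z + (y - phi(z)), the surjectivity. *)

Set Implicit Arguments.
Unset Strict Implicit.
Unset Printing Implicit Defensive.

(** * Polynomials modulo a power of X *)

(** Power series occur only through such congruences. Stated as divisibility, they make products,
    composition and cancellation a matter of divisors. *)
Definition eqm (K : fieldType) (n : nat) (f g : {poly K}) : bool := ('X^n %| f - g)%R.

Section Eqm.
Context {K : fieldType}.
Implicit Types (f g h u : {poly K}) (n : nat).

Lemma eqmP n f g : reflect (forall i, (i < n)%N -> f`_i = g`_i) (eqm n f g).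
Proof.
apply: (iffP idP) => [/dvdpP [q Eq] i lt_in | Efg].
  by apply/eqP; rewrite -subr_eq0 -coefB Eq coefMXn lt_in.
apply/dvdpP; exists (drop_poly n (f - g)).
rewrite -[LHS](poly_take_drop n) [X in X + _](_ : _ = 0) ?add0r //.
by apply/polyP => i; rewrite coef_take_poly coef0; case: ifP => // /Efg E; rewrite coefB E subrr.
Qed.

Lemma eqm_refl n f : eqm n f f. Proof. exact/eqmP. Qed.

Lemma eqm_sym n f g : eqm n f g -> eqm n g f.
Proof. by move/eqmP => E; apply/eqmP => i /E. Qed.

Lemma eqm_trans n g f h : eqm n f g -> eqm n g h -> eqm n f h.
Proof. by move=> /eqmP E /eqmP E'; apply/eqmP => i lt_in; rewrite E // E'. Qed.

Lemma eqm_leq m n f g : (m <= n)%N -> eqm n f g -> eqm m f g.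
Proof. by move=> le_mn /eqmP E; apply/eqmP => i lt_im; apply/E/(leq_trans lt_im). Qed.

Lemma eqmD n f f' g g' : eqm n f f' -> eqm n g g' -> eqm n (f + g) (f' + g').
Proof. by move=> /eqmP E /eqmP E'; apply/eqmP => i lt_in; rewrite !coefD E // E'. Qed.

Lemma eqmM n f f' g g' : eqm n f f' -> eqm n g g' -> eqm n (f * g) (f' * g').
Proof.
move=> E E'; rewrite /eqm (_ : _ - _ = (f - f') * g + f' * (g - g')); last by ring.
by apply: dvdp_add; [apply: dvdp_mulr | apply: dvdp_mull].
Qed.

Lemma eqmMl n f g h : eqm n f g -> eqm n (h * f) (h * g).
Proof. by move=> E; apply: eqmM => //; apply: eqm_refl. Qed.

Lemma eqmX n k f g : eqm n f g -> eqm n (f ^+ k) (g ^+ k).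
Proof.
by move=> E; elim: k => [|k IHk]; [rewrite !expr0 eqm_refl | rewrite !exprS eqmM].
Qed.

Lemma eqm_comp n f g u : u`_0 = 0 -> eqm n f g -> eqm n (f \Po u) (g \Po u).
Proof.
move=> u0 /dvdpP [q Eq]; rewrite /eqm -rmorphB /= Eq comp_polyM comp_Xn_poly.
apply/dvdp_mull/dvdp_exp2r; have /dvdpP [v] : eqm 1 u 0.
  by apply/eqmP => -[|i] // _; rewrite u0 coef0.
by rewrite subr0 expr1 => ->; rewrite dvdp_mulIr.
Qed.

Lemma eqm_comp_Xn n k f g : eqm n f g -> eqm (n * k) (f \Po 'X^k) (g \Po 'X^k).
Proof.
move=> /dvdpP [q Eq]; rewrite /eqm -rmorphB /= Eq comp_polyM comp_Xn_poly.
by rewrite -exprM mulnC dvdp_mulIr.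
Qed.

(** The cofactor of [f - g] in [f ^+ k - g ^+ k] has constant term [k], hence is coprime to X. *)
Lemma eqm_root n k f g : k%:R != 0 :> K -> f`_0 = 1 -> g`_0 = 1 ->
  eqm n (f ^+ k) (g ^+ k) -> eqm n f g.
Proof.
move=> nzk f0 g0; rewrite /eqm subrXX Gauss_dvdpl //.
apply: coprimep_expl; rewrite coprimep_sym coprimepX /root.
rewrite horner_sum (eq_bigr (fun=> 1)) ?sumr_const ?card_ord // => i _.
by rewrite hornerM !horner_exp !horner_coef0 f0 g0 !expr1n mulr1.
Qed.

End Eqm.

(** The geometric series of 1/f, cut after [n] terms. Being a polynomial in [f], it inherits the
    weighted bounds on [f]. *)
Definition trunc_inv (K : fieldType) n (f : {poly K}) : {poly K} := \sum_(k < n) (1 - f) ^+ k.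

Lemma trunc_invP (K : fieldType) n (f : {poly K}) : f`_0 = 1 -> eqm n (f * trunc_inv n f) 1.
Proof.
move=> f0; apply: eqm_sym; rewrite /eqm (_ : 1 - _ = (1 - f) ^+ n).
  apply: dvdp_exp2r; have : eqm 1 1 f.
    by apply/eqmP => -[|i] // _; rewrite f0 coef1.
  by rewrite /eqm expr1.
have : (1 - f) ^+ n - 1 = (1 - f - 1) * trunc_inv n f by rewrite subrX1.
move/(congr1 (+%R^~ 1)); rewrite subrK => ->.
by set S := trunc_inv n f; ring.
Qed.

Lemma trunc_inv0 (K : fieldType) n (f : {poly K}) : f`_0 = 1 -> (trunc_inv n.+1 f)`_0 = 1.
Proof.
move=> f0; have /eqmP/(_ 0%N isT) := trunc_invP n.+1 f0.
by rewrite coef0M f0 mul1r coef1.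
Qed.

(* Binomial coefficients: [(1 + c X) ^ (1/D) = \sum_k rbin c D k X ^ k]. *)
Fixpoint rbin (K : fieldType) (c : K) (D k : nat) : K :=
  if k is j.+1 then c * (1 - (D * j)%:R) / (D * j.+1)%:R * rbin c D j else 1.

(** The recursion defining [rbin] says that D (1 + c X) e' = c e, so H = e^D solves (1 + c X) H' = c
    H. In characteristic 0 this equation and H(0) = 1 determine H, and 1 + c X is a solution. *)
Lemma rbinP (K : fieldType) (c : K) D n : (forall m, (0 < m)%N -> m%:R != 0 :> K) ->
  (0 < D)%N -> eqm n.+1 ((\poly_(k < n.+1) rbin c D k) ^+ D) (1 + c%:P * 'X).
Proof.
move=> K0 D0; set e := \poly_(k < _) _; set H := e ^+ D.
pose l := 1 + c%:P * 'X : {poly K}.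
have eE i : (i < n.+1)%N -> e`_i = rbin c D i by move=> lt_in; rewrite coef_poly lt_in.
have Xderiv (f : {poly K}) i : ('X * f^`())`_i = f`_i *+ i.
  by rewrite coefXM coef_deriv; case: i.
have ode_e : eqm n (D%:R * (l * e^`())) (c%:P * e).
  apply/eqmP => i lt_in; rewrite mulr_natl coefMn -[LHS]mulr_natl coefCM mulrDl mul1r -mulrA.
  rewrite coefD coefCM Xderiv coef_deriv !eE ?ltnS //; last exact: ltnW.
  rewrite -[rbin c D i.+1 *+ _]mulr_natl -[rbin c D i *+ _]mulr_natl /=.
  move: (K0 _ D0) (K0 i.+1 isT); rewrite !natrM -(natr1 i).
  move: D%:R i%:R (rbin c D i) => x y z x0 y0.
  by field; rewrite x0 y0.
have ode_H : eqm n (l * H^`()) (c%:P * H).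
  rewrite /H deriv_exp; case: (D) D0 ode_e => // k _ /(eqmMl (e ^+ k)) E /=.
  have -> : l * (e^`() * e ^+ k *+ k.+1) = e ^+ k * (k.+1%:R * (l * e^`())).
    by rewrite -[_ *+ _]mulr_natl; move: k.+1%:R => x; ring.
  by have -> : c%:P * e ^+ k.+1 = e ^+ k * (c%:P * e) by rewrite exprS; ring.
have H0 : H`_0 = 1.
  by rewrite -horner_coef0 horner_exp horner_coef0 coef_poly /= expr1n.
(* That is, (i+1) H_(i+1) = c (1 - i) H_i: the factor 1 - i kills H_2 and with it all later
   coefficients. *)
have rec i : (i < n)%N -> H`_i.+1 *+ i.+1 + c * (H`_i *+ i) = c * H`_i.
  move=> lt_in; have /eqmP/(_ i lt_in) := ode_H.
  by rewrite mulrDl mul1r -mulrA coefD !coefCM Xderiv coef_deriv => <-.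
have H1 : (0 < n)%N -> H`_1 = c.
  by move=> n0; have := rec 0%N n0; rewrite mulr1n mulr0n mulr0 addr0 H0 mulr1.
have H2 i : (i.+1 < n)%N -> H`_i.+2 = 0.
  elim: i => [|i IHi] lt_in; have := rec _ lt_in.
    rewrite mulr1n H1; last exact: ltnW.
    by move/eqP; rewrite -subr_eq0 addrK -mulr_natr mulf_eq0 (negPf (K0 _ _)) // orbF => /eqP.
  rewrite IHi ?(ltnW lt_in) // mul0rn mulr0 addr0 => /eqP.
  by rewrite -mulr_natr mulf_eq0 (negPf (K0 _ _)) // orbF => /eqP.
apply/eqmP => -[|[|i]] lt_in; rewrite coefD coef1 coefCM coefX ?mulr0 ?mulr1 ?addr0 ?add0r //=.
- by rewrite H1.
- by rewrite H2.
Qed.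

(** * Non-archimedean absolute values *)

Definition ultranorm (R : realFieldType) (K : fieldType) (nrm : K -> R) :=
  [/\ forall x, 0 <= nrm x, forall x, nrm x = 0 <-> x = 0,
      forall x y, nrm (x * y) = nrm x * nrm y
    & forall x y, nrm (x + y) <= Num.max (nrm x) (nrm y)].

Section Ultranorm.
Context {R : realFieldType} {K : fieldType} {nrm : K -> R}.
Hypothesis Hn : ultranorm nrm.

Lemma unrm_ge0 x : 0 <= nrm x. Proof. by case: Hn. Qed.

Lemma unrmM x y : nrm (x * y) = nrm x * nrm y. Proof. by case: Hn. Qed.

Lemma unrm_eq0 x : (nrm x == 0) = (x == 0).
Proof. by case: Hn => _ H _ _; apply/eqP/eqP => /H. Qed.

Lemma unrm0 : nrm 0 = 0. Proof. by apply/eqP; rewrite unrm_eq0. Qed.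

Lemma unrm_gt0 x : (0 < nrm x) = (x != 0).
Proof. by rewrite lt_def unrm_ge0 andbT unrm_eq0. Qed.

Lemma unrm1 : nrm 1 = 1.
Proof.
have n1 : nrm 1 != 0 by rewrite unrm_eq0 oner_neq0.
by apply: (mulfI n1); rewrite -unrmM !mulr1.
Qed.

Lemma unrmN1 : nrm (- 1) = 1.
Proof.
have : nrm (- 1) ^+ 2 = 1 by rewrite expr2 -unrmM mulrNN mulr1 unrm1.
by move/eqP; rewrite sqrp_eq1 ?unrm_ge0 // => /eqP.
Qed.

Lemma unrmN x : nrm (- x) = nrm x.
Proof. by rewrite -mulN1r unrmM unrmN1 mul1r. Qed.

Lemma unrmC x y : nrm (x - y) = nrm (y - x).
Proof. by rewrite -unrmN opprB. Qed.

Lemma unrmX x k : nrm (x ^+ k) = nrm x ^+ k.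
Proof. by elim: k => [|k IHk]; rewrite ?unrm1 // !exprS unrmM IHk. Qed.

Lemma unrmV x : nrm x^-1 = (nrm x)^-1.
Proof.
have [->|nz] := eqVneq x 0; first by rewrite invr0 unrm0 invr0.
have nz' : nrm x != 0 by rewrite unrm_eq0.
by apply: (mulfI nz'); rewrite -unrmM !mulfV // unrm1.
Qed.

Lemma unrmD_le x y C : nrm x <= C -> nrm y <= C -> nrm (x + y) <= C.
Proof.
by case: Hn => _ _ _ H hx hy; apply: le_trans (H x y) _; rewrite ge_max hx.
Qed.

Lemma unrmD_lt x y C : nrm x < C -> nrm y < C -> nrm (x + y) < C.
Proof.
by case: Hn => _ _ _ H hx hy; apply: le_lt_trans (H x y) _; rewrite gt_max hx.
Qed.

Lemma unrmB_le x y C : nrm x <= C -> nrm y <= C -> nrm (x - y) <= C.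
Proof. by move=> hx hy; apply: unrmD_le; rewrite ?unrmN. Qed.

Lemma unrm_sum_le (I : Type) (s : seq I) (P : pred I) (F : I -> K) C : 0 <= C ->
  (forall i, P i -> nrm (F i) <= C) -> nrm (\sum_(i <- s | P i) F i) <= C.
Proof.
move=> C0 H; elim/big_ind : _ => // [|x y]; [by rewrite unrm0 | exact: unrmD_le].
Qed.

Lemma unrm_sum_lt (I : Type) (s : seq I) (P : pred I) (F : I -> K) C : 0 < C ->
  (forall i, P i -> nrm (F i) < C) -> nrm (\sum_(i <- s | P i) F i) < C.
Proof.
move=> C0 H; elim/big_ind : _ => // [|x y]; [by rewrite unrm0 | exact: unrmD_lt].
Qed.

(** Ultrametric triangles are isosceles; this is how the exact size of a sum is read off from one
    dominant term. *)
Lemma unrm_eq x y : nrm (x - y) < nrm y -> nrm x = nrm y.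
Proof.
move=> lt; apply/eqP; rewrite eq_le -{1}(subrK y x) unrmD_le ?(ltW lt) //=.
rewrite leNgt; apply/negP => ltx.
by have := unrmD_lt (_ : nrm (y - x) < nrm y) ltx; rewrite unrmC subrK ltxx => /(_ lt).
Qed.

Lemma unrm_nat_le1 k : nrm k%:R <= 1.
Proof. by elim: k => [|k IHk]; rewrite ?unrm0 // -natr1 unrmD_le ?unrm1. Qed.

End Ultranorm.

(** * Weighted bounds on coefficients *)

(** The last inequality is what makes the polynomials with coefficients bounded by [w] closed under
    products, hence under truncated inverses. *)
Definition weight (R : realFieldType) (w : nat -> R) :=
  [/\ w 0%N = 1, forall i, 0 <= w i & forall i j, w i * w j <= w (i + j)%N].

Lemma weight_exp (R : realFieldType) (s : R) : 0 <= s -> weight (fun i => s ^+ i).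
Proof. by move=> s0; split => // [i|i j]; [exact: exprn_ge0 | rewrite exprD]. Qed.

(** It lies below r^i by a fixed factor in every positive degree; this room later allows the radius
    to be shrunk. *)
Definition eta_weight (R : realFieldType) (eta r : R) (i : nat) : R :=
  if i is 0 then 1 else eta * r ^+ i.

Lemma weight_eta (R : realFieldType) (eta r : R) : 0 <= eta <= 1 -> 0 <= r ->
  weight (eta_weight eta r).
Proof.
move=> /andP [e0 e1] r0; split => [//|[|i]|[|i] [|j]] /=;
  rewrite ?mul1r ?mulr1 ?addn0 ?ler01 // ?mulr_ge0 ?exprn_ge0 //.
rewrite exprD (_ : _ * _ = eta * (eta * (r ^+ i.+1 * r ^+ j.+1))); last by ring.
by rewrite ler_wpM2l // ler_piMl // mulr_ge0 ?exprn_ge0.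
Qed.

Definition bdd (R : realFieldType) (K : fieldType) (nrm : K -> R) (w : nat -> R) (M : nat)
  (q : {poly K}) := forall i, (i < M)%N -> nrm q`_i <= w i.

Section Bounded.
Context {R : realFieldType} {K : fieldType} {nrm : K -> R}.
Hypothesis Hn : ultranorm nrm.
Variable w : nat -> R.
Hypothesis Hw : weight w.
Implicit Types (f g q : {poly K}) (M : nat).

Let w_ge0 i : 0 <= w i. Proof. by case: Hw. Qed.

Lemma bdd_leq M M' q : (M <= M')%N -> bdd nrm w M' q -> bdd nrm w M q.
Proof. by move=> le H i /leq_trans/(_ le)/H. Qed.

Lemma bdd_eqm M f g : eqm M f g -> bdd nrm w M f -> bdd nrm w M g.
Proof. by move=> /eqmP E H i lt; rewrite -E // H. Qed.

Lemma bdd0 M : bdd nrm w M 0. Proof. by move=> i _; rewrite coef0 unrm0. Qed.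

Lemma bdd1 M : bdd nrm w M 1.
Proof.
by move=> [|i] _; rewrite coef1 /= ?unrm0 // unrm1 //; case: Hw => ->.
Qed.

Lemma bddD M f g : bdd nrm w M f -> bdd nrm w M g -> bdd nrm w M (f + g).
Proof. by move=> Hf Hg i lt; rewrite coefD unrmD_le ?Hf ?Hg. Qed.

Lemma bddB M f g : bdd nrm w M f -> bdd nrm w M g -> bdd nrm w M (f - g).
Proof. by move=> Hf Hg i lt; rewrite coefB unrmB_le ?Hf ?Hg. Qed.

Lemma bddM M f g : bdd nrm w M f -> bdd nrm w M g -> bdd nrm w M (f * g).
Proof.
move=> Hf Hg i lt; rewrite coefM; apply: unrm_sum_le => // j _.
have le_ji : (j <= i)%N by rewrite -ltnS.
rewrite unrmM // -[X in w X](subnKC le_ji); case: Hw => _ _ wM; apply: le_trans (wM _ _).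
by rewrite ler_pM ?unrm_ge0 ?Hf ?Hg // (leq_ltn_trans _ lt) ?leq_subr.
Qed.

Lemma bddX M k f : bdd nrm w M f -> bdd nrm w M (f ^+ k).
Proof.
by move=> Hf; elim: k => [|k IHk]; rewrite ?expr0 ?exprS; [exact: bdd1 | exact: bddM].
Qed.

Lemma bdd_sum (I : Type) (s : seq I) (P : pred I) (F : I -> {poly K}) M :
  (forall i, P i -> bdd nrm w M (F i)) -> bdd nrm w M (\sum_(i <- s | P i) F i).
Proof. by move=> H; elim/big_ind : _ => //; [exact: bdd0 | exact: bddD]. Qed.

Lemma bdd_prod (I : Type) (s : seq I) (P : pred I) (F : I -> {poly K}) M :
  (forall i, P i -> bdd nrm w M (F i)) -> bdd nrm w M (\prod_(i <- s | P i) F i).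
Proof. by move=> H; elim/big_ind : _ => //; [exact: bdd1 | exact: bddM]. Qed.

Lemma bdd_trunc_inv M n f : bdd nrm w M f -> bdd nrm w M (trunc_inv n f).
Proof. by move=> Hf; apply: bdd_sum => i _; apply/bddX/bddB => //; apply: bdd1. Qed.

(** Since n > 0, a term with k > 0 shifts degrees: the coefficient of degree i of the composite
    involves [q] only in degrees below i. The bound thus gains one degree over that on [q], which
    drives the inductions on precision below. *)
Lemma bdd_comp M n g q : (0 < n)%N -> (forall k, (k <= M)%N -> nrm g`_k <= w (n * k)%N) ->
  bdd nrm w M q -> bdd nrm w M.+1 (g \Po ('X^n * q)).
Proof.
move=> n0 Hg Hq i lt_iM; rewrite comp_polyE coef_sum; apply: unrm_sum_le => // k _.
rewrite coefZ exprMn -exprM coefXnM unrmM //.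
case: ltnP => [_|le_nki]; first by rewrite unrm0 // mulr0.
have le_ki : (k <= i)%N by apply: leq_trans le_nki; rewrite leq_pmull.
case: Hw => w0 _ wM; rewrite -[X in w X](subnKC le_nki); apply: le_trans (wM _ _).
rewrite ler_pM ?unrm_ge0 ?Hg //; first by apply: leq_trans le_ki _; rewrite -ltnS.
case: (posnP k) => [k0|k0]; first by rewrite k0 expr0; apply: bdd1 (ltnSn _).
apply: (bddX _ Hq); apply: leq_trans (_ : (i - n * k < i)%N) _; last by rewrite -ltnS.
by rewrite ltn_subrL muln_gt0 n0 k0 (leq_trans k0).
Qed.

Lemma bdd_comp_Xn (w' : nat -> R) M k q : (0 < k)%N ->
  (forall i, w' i <= w (k * i)%N) -> bdd nrm w' M q -> bdd nrm w (M * k) (q \Po 'X^k).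
Proof.
move=> k0 Hw' Hq i lt_i; rewrite coef_comp_poly_Xn //.
case: ifP => [/dvdnP [j ij]|_]; last by rewrite unrm0.
move: lt_i; rewrite ij mulnK // ltn_pmul2r // => lt_j.
by apply: le_trans (Hq _ lt_j) _; rewrite mulnC.
Qed.

End Bounded.

(** * Legendre's formula and the binomial coefficients *)

Section Legendre.
Variable p : nat.
Hypothesis p_pr : prime p.

(** The quotient [k %/ p ^ m] is what remains for the later terms; keeping it at least 1 makes the
    final bound k - 1 rather than k. *)
Lemma legendre_sum k m : (0 < k)%N ->
  (p.-1 * \sum_(1 <= i < m.+1) k %/ p ^ i + maxn 1 (k %/ p ^ m) <= k)%N.
Proof.
move=> k0; elim: m => [|m IHm].
  by rewrite big_geq // muln0 expn0 divn1 add0n geq_max k0 leqnn.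
rewrite big_nat_recr //= mulnDr; apply: leq_trans IHm; rewrite -addnA leq_add2l.
rewrite expnSr divnMA; move: (k %/ p ^ m)%N => x.
case: (x %/ p)%N (leq_trunc_div x p) => [|y] le_x.
  by rewrite muln0 add0n maxn0 leq_maxl.
rewrite (maxn_idPr _) // -mulSnr prednK ?prime_gt0 // mulnC.
exact: leq_trans le_x (leq_maxr _ _).
Qed.

Lemma logn_fact_le k : (0 < k)%N -> (p.-1 * logn p k`! <= k.-1)%N.
Proof.
move=> k0; rewrite logn_fact // -ltnS prednK // -addn1.
by apply: leq_trans (legendre_sum k k0); rewrite leq_add2l leq_maxl.
Qed.

(** For i <= t the divisions by p^i are exact, so the partial sums up to m telescope with remainder
    p^(t - m). *)
Lemma logn_fact_pexp t : (p.-1 * logn p (p ^ t)`! = (p ^ t).-1)%N.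
Proof.
have p1 := prime_gt1 p_pr; have pt0 : (0 < p ^ t)%N by rewrite expn_gt0 ltnW.
apply/eqP; rewrite eqn_leq logn_fact_le //= logn_fact //.
have le_t : (t.+1 <= (p ^ t).+1)%N by rewrite ltnS ltnW // ltn_expl.
rewrite (big_cat_nat (n := t.+1)) //= mulnDr; move: (p.-1 * \sum_(t.+1 <= i < _) _)%N => S.
suff E : (p.-1 * \sum_(1 <= i < t.+1) p ^ t %/ p ^ i + 1 = p ^ t)%N.
  by rewrite -[X in (X.-1 <= _)%N]E addn1 leq_addr.
have H m : (m <= t)%N ->
    (p.-1 * \sum_(1 <= i < m.+1) p ^ t %/ p ^ i + p ^ (t - m) = p ^ t)%N.
  elim: m => [|m IHm] lt_mt; first by rewrite big_geq // muln0 subn0.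
  rewrite big_nat_recr //= mulnDr -[RHS](IHm (ltnW lt_mt)) -addnA; congr addn.
  rewrite -expnB // ?(ltnW p1) // -(subnSK lt_mt) expnS; move: (p ^ _)%N => x.
  by rewrite -{2}[x]mul1n -mulnDl addn1 prednK // ltnW.
by have := H t (leqnn t); rewrite subnn.
Qed.

End Legendre.

Section PadicNorm.
Context {R : realFieldType} {K : fieldType} {nrm : K -> R}.
Hypothesis Hn : ultranorm nrm.
Variable p : nat.
Hypothesis p_pr : prime p.
Hypothesis nrm_p : nrm p%:R = p%:R^-1.

Let p_gt0 : 0 < p%:R :> R. Proof. by rewrite ltr0n prime_gt0. Qed.

Let p_gt1 : 1 < p%:R :> R. Proof. by rewrite ltr1n prime_gt1. Qed.

Let pV_lt1 : p%:R^-1 < 1 :> R. Proof. by rewrite invf_lt1. Qed.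

Lemma unrm_nat_dvd m : (p %| m)%N -> nrm m%:R <= p%:R^-1.
Proof.
case/dvdnP => k ->; rewrite natrM unrmM // nrm_p ler_piMl ?invr_ge0 ?(ltW p_gt0) //.
exact: unrm_nat_le1.
Qed.

(** In a Bezout relation 1 = u m - v p the term v p has absolute value below 1, so |m| < 1 would
    give |1| < 1. *)
Lemma unrm_nat_coprime m : coprime p m -> nrm m%:R = 1.
Proof.
case: m => [|m] co; first by rewrite /coprime gcdn0 in co; move/eqP: co p_pr => ->.
case: (egcdnP p (ltn0Sn m)) => u v Euv _; apply/eqP; rewrite eq_le unrm_nat_le1 //=.
rewrite leNgt; apply/negP => lt1.
have: 1%:R = u%:R * m.+1%:R - v%:R * p%:R :> K.
  by rewrite -!natrM Euv gcdnC (eqP co) natrD addrAC subrr add0r.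
move/(congr1 nrm); rewrite (unrm1 Hn) => E; suff : 1 < 1 :> R by rewrite ltxx.
rewrite {1}E; apply: (unrmD_lt Hn); rewrite ?unrmN // unrmM //.
  by apply: le_lt_trans lt1; rewrite ler_piMl ?unrm_ge0 // unrm_nat_le1.
by rewrite nrm_p (le_lt_trans _ pV_lt1) // ler_piMl ?invr_ge0 ?(ltW p_gt0) // unrm_nat_le1.
Qed.

Lemma unrm_nat m : (0 < m)%N -> nrm m%:R = p%:R ^- logn p m.
Proof.
move=> m0; have [k co ->] := pfactor_coprime p_pr m0.
rewrite natrM natrX unrmM // unrmX // nrm_p unrm_nat_coprime // mul1r exprVn.
rewrite lognM ?expn_gt0 ?(prime_gt0 p_pr) //; last first.
  by case: k co => //; rewrite /coprime gcdn0 => /eqP Ep; move: p_pr; rewrite Ep.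
by rewrite pfactorK // (logn_coprime co) add0n.
Qed.

Lemma unrm_natr_neq0 m : (0 < m)%N -> m%:R != 0 :> K.
Proof.
by move=> m0; rewrite -(unrm_gt0 Hn) unrm_nat // invr_gt0 exprn_gt0.
Qed.

(** This is p^(1/(p-1)), given through its power so that the estimates avoid real exponents. *)
Variable q : R.
Hypotheses (q_ge1 : 1 <= q) (q_p : q ^+ p.-1 = p%:R).

Lemma unrm_fact_le k : (0 < k)%N -> (nrm (k`!)%:R)^-1 <= q ^+ k.-1.
Proof.
move=> k0; rewrite unrm_nat ?fact_gt0 // invrK -q_p -exprM.
exact/(ler_weXn2l q_ge1)/logn_fact_le.
Qed.

Lemma unrm_fact_pexp t : (nrm ((p ^ t)`!)%:R)^-1 = q ^+ (p ^ t).-1.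
Proof. by rewrite unrm_nat ?fact_gt0 // invrK -q_p -exprM logn_fact_pexp. Qed.

Variables (c : K) (D : nat).
Hypothesis p_D : (p %| D)%N.

(** As p divides D, the numerators 1 - D k are units, and only the denominators D (k+1) count. *)
Lemma unrm_rbin k : nrm (rbin c D k) = (nrm c / nrm D%:R) ^+ k / nrm (k`!)%:R.
Proof.
elim: k => [|k IHk]; first by rewrite fact0 expr0 mul1r !(unrm1 Hn) invr1.
have u : nrm (1 - (D * k)%:R) = 1.
  rewrite -(unrm1 Hn); apply: (unrm_eq Hn); rewrite (unrm1 Hn) addrAC subrr add0r unrmN //.
  by apply: le_lt_trans pV_lt1; apply: unrm_nat_dvd; apply: dvdn_mulr.
rewrite -[rbin c D k.+1]/(c * (1 - (D * k)%:R) / (D * k.+1)%:R * rbin c D k).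
rewrite (unrmM Hn) IHk 2!(unrmM Hn) (unrmV Hn) u factS.
rewrite (natrM K k.+1) (natrM K D k.+1) 2!(unrmM Hn) !invfM exprS.
by move: (nrm c) (_^-1) (_^-1) (_^-1) => x y z t; ring.
Qed.

(** The factor [q^-1] comes from the exponent k - 1 in Legendre's bound; it keeps the coefficients
    strictly below the pure geometric growth. *)
Lemma unrm_rbin_le k : (0 < k)%N ->
  nrm (rbin c D k) <= q^-1 * (nrm c / nrm D%:R * q) ^+ k.
Proof.
move=> k0; have q0 : 0 < q by apply: lt_le_trans q_ge1.
have b0 : 0 <= nrm c / nrm D%:R by rewrite mulr_ge0 ?invr_ge0 ?unrm_ge0.
rewrite unrm_rbin; move: (nrm c / _) b0 => b b0.
rewrite exprMn (mulrCA q^-1) ler_wpM2l ?exprn_ge0 //.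
by rewrite -[k in X in _ <= X](prednK k0) exprS mulKf ?gt_eqF // unrm_fact_le.
Qed.

Lemma unrm_rbin_pexp t :
  nrm (rbin c D (p ^ t)) = q^-1 * (nrm c / nrm D%:R * q) ^+ (p ^ t).
Proof.
have q0 : 0 < q by apply: lt_le_trans q_ge1.
have k0 : (0 < p ^ t)%N by rewrite expn_gt0 prime_gt0.
rewrite unrm_rbin; move: (nrm c / _) => b.
rewrite exprMn (mulrCA q^-1) unrm_fact_pexp; congr (_ * _).
by rewrite -{2}(prednK k0) exprS mulKf ?gt_eqF.
Qed.

End PadicNorm.

(** * Factorisation of the series F with F(x)^d = F(x^d) + c x *)

(** The factor E_i, with the binomial series and 1/F replaced by polynomials correct modulo
    X^(M+1). *)
Definition binfac (K : fieldType) (c : K) (d M : nat) (F : {poly K}) (i : nat) : {poly K} :=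
  (\poly_(k < M.+1) rbin c (d ^ i.+1) k)
    \Po ('X^(d ^ i) * (trunc_inv M.+1 F \Po 'X^(d ^ i.+1))).

Section Factorisation.
Variables (K : fieldType) (c : K) (d M : nat) (F : {poly K}).
Hypothesis K0 : forall m, (0 < m)%N -> m%:R != 0 :> K.
Hypothesis d_gt1 : (1 < d)%N.
Hypothesis F0 : F`_0 = 1.
Hypothesis F_eq : eqm M.+1 (F ^+ d) (F \Po 'X^d + c%:P * 'X).

Let d_gt0 : (0 < d)%N. Proof. exact: ltnW. Qed.

Let di_gt0 i : (0 < d ^ i)%N. Proof. by rewrite expn_gt0 d_gt0. Qed.

Let comp_XnXn (f : {poly K}) i j : (f \Po 'X^i) \Po 'X^j = f \Po 'X^(i * j).
Proof. by rewrite -comp_polyA comp_Xn_poly -exprM mulnC. Qed.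

Let comp_exp (f u : {poly K}) k : (f ^+ k) \Po u = (f \Po u) ^+ k.
Proof. exact: rmorphXn. Qed.

Lemma binfac0 i : (binfac c d M F i)`_0 = 1.
Proof.
rewrite -horner_coef0 horner_comp hornerM hornerXn expr0n -leqn0 leqNgt di_gt0 mul0r.
by rewrite horner_coef0 coef_poly.
Qed.

Lemma binfac_exp i : eqm M.+1 (binfac c d M F i ^+ (d ^ i.+1))
  (1 + c%:P * ('X^(d ^ i) * (trunc_inv M.+1 F \Po 'X^(d ^ i.+1)))).
Proof.
rewrite -comp_exp; set u := 'X^_ * _.
have u0 : u`_0 = 0 by rewrite coefXnM di_gt0.
have := eqm_comp u0 (rbinP c M K0 (di_gt0 i.+1)).
by rewrite comp_polyD comp_polyM !comp_polyC comp_polyX.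
Qed.

(** Substitute x^(d^i) in the equation of F and take F(x^(d^(i+1))) out of the right-hand side. *)
Lemma binfac_step i :
  eqm M.+1 ((F \Po 'X^(d ^ i)) ^+ d) ((F \Po 'X^(d ^ i.+1)) * binfac c d M F i ^+ (d ^ i.+1)).
Proof.
have leM k : (0 < k)%N -> (M.+1 <= M.+1 * k)%N by move=> k0; rewrite leq_pmulr.
rewrite -comp_exp; apply: eqm_trans (eqm_leq (leM _ (di_gt0 i)) (eqm_comp_Xn _ F_eq)) _.
rewrite comp_polyD comp_XnXn -expnS comp_polyM comp_polyC comp_polyX.
apply: eqm_trans (eqmMl _ (eqm_sym (binfac_exp i))).
rewrite mulrDr mulr1; apply: eqmD; first exact: eqm_refl.
set W := trunc_inv _ _ \Po _; set V := F \Po _.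
have VW : eqm M.+1 (V * W) 1.
  have := eqm_leq (leM _ (di_gt0 i.+1)) (eqm_comp_Xn (d ^ i.+1) (trunc_invP M.+1 F0)).
  by rewrite comp_polyM comp_polyC.
have -> : V * (c%:P * ('X^(d ^ i) * W)) = (c%:P * 'X^(d ^ i)) * (V * W) by ring.
by apply: eqm_trans (eqmMl _ (eqm_sym VW)); rewrite mulr1 eqm_refl.
Qed.

(** Stating the telescoped product for d^L-th powers postpones the extraction of roots to a single
    use of [eqm_root]. *)
Lemma binfac_prod_exp L :
  eqm M.+1 (F ^+ (d ^ L)) ((F \Po 'X^(d ^ L)) * (\prod_(i < L) binfac c d M F i) ^+ (d ^ L)).
Proof.
elim: L => [|L IHL]; first by rewrite big_ord0 expr1n mulr1 expn0 expr1 comp_polyXr eqm_refl.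
rewrite expnSr exprM; apply: eqm_trans (eqmX d IHL) _.
rewrite exprMn -exprM -expnSr big_ord_recr /= exprMn.
move: ((\prod_(i < L) _) ^+ _) => P; rewrite [P * _]mulrC mulrA.
by apply: eqmM (eqm_refl _ _); apply: binfac_step.
Qed.

(** After M+1 steps the remaining term F(x^(d^(M+1))) is 1 at this precision, since d^(M+1) > M. *)
Lemma binfac_prod : eqm M.+1 F (\prod_(i < M.+1) binfac c d M F i).
Proof.
have nz : (d ^ M.+1)%:R != 0 :> K by apply: K0.
apply: (eqm_root nz F0).
  rewrite -horner_coef0 horner_prod big1 // => i _.
  by rewrite horner_coef0 binfac0.
apply: eqm_trans (binfac_prod_exp _) _.
rewrite -[X in eqm _ _ X]mul1r; apply: eqmM (eqm_refl _ _).
apply: eqm_leq (_ : 1 * d ^ M.+1 >= _)%N _; first by rewrite mul1n ltnW // ltn_expl.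
have -> : 1 = (1 : {poly K}) \Po 'X^(d ^ M.+1) by rewrite comp_polyC.
by apply: eqm_comp_Xn; apply/eqmP => -[|i] // _; rewrite F0 coef1.
Qed.

End Factorisation.

Section FactorBounds.
Context {R : realFieldType} {K : fieldType} {nrm : K -> R}.
Hypothesis Hn : ultranorm nrm.
Variables (c : K) (d M : nat) (F : {poly K}) (w w' : nat -> R).
Hypotheses (Hw : weight w) (Hw' : weight w').
Hypothesis d_gt0 : (0 < d)%N.

(** F enters E_i only after the substitution x^(d^(i+1)), so a weaker weight [w'] for F may still
    give the sharper [w] for E_i. *)
Lemma bdd_binfac i : bdd nrm w' M F -> (forall j, w' j <= w (d ^ i.+1 * j)%N) ->
  (forall k, nrm (rbin c (d ^ i.+1) k) <= w (d ^ i * k)%N) ->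
  bdd nrm w M.+1 (binfac c d M F i).
Proof.
move=> HF Hww Hb; have di_gt0 j : (0 < d ^ j)%N by rewrite expn_gt0 d_gt0.
apply: bdd_comp => // [k le_kM|]; first by rewrite coef_poly ltnS le_kM.
apply: (@bdd_leq _ _ _ _ M (M * d ^ i.+1)); first by rewrite leq_pmulr.
by apply: bdd_comp_Xn (di_gt0 _) Hww _ => //; apply: bdd_trunc_inv.
Qed.

End FactorBounds.

(** * Coefficients of F *)

(* [Num.Theory] also exports a [trunc1]. *)
Local Notation trunc1 := Defs.trunc1.

Lemma coef_trunc1 (K : fieldType) (a : nat -> K) M i : (i <= M)%N ->
  (trunc1 a M)`_i = ser1 a i.
Proof. by move=> le_iM; rewrite coef_poly ltnS le_iM. Qed.

Lemma eqm_trunc1 (K : fieldType) (a : nat -> K) M M' : (M <= M')%N ->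
  eqm M.+1 (trunc1 a M') (trunc1 a M).
Proof.
move=> le; apply/eqmP => i; rewrite ltnS => lei.
by rewrite !coef_trunc1 // (leq_trans lei).
Qed.

Lemma bdd_trunc1 (R : realFieldType) (K : fieldType) (nrm : K -> R) w (a : nat -> K) M M' :
  (M <= M'.+1)%N ->
  bdd nrm w M (trunc1 a M') <-> (forall i, (i < M)%N -> nrm (ser1 a i) <= w i).
Proof.
move=> le; split=> H i lt_i; have := H i lt_i; rewrite coef_trunc1 // -ltnS;
  exact: leq_trans lt_i le.
Qed.

(** The hypothesis fixes only the coefficient of degree M of the truncation at M; a lower degree i
    is reached by truncating at i instead. *)
Lemma trunc1_phi (K : fieldType) (d : nat) (c : K) (a : nat -> K) M : (1 < d)%N ->
  is_phi_seq d c a -> eqm M.+1 (trunc1 a M ^+ d) (trunc1 a M \Po 'X^d + c%:P * 'X).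
Proof.
move=> d1 Ha; apply/eqmP => i; rewrite ltnS => le_iM.
have /eqmP/(_ i (ltnSn i)) -> := eqmX d (eqm_trunc1 a le_iM).
rewrite Ha coefD coefCM coefX coef_comp_poly_Xn; last exact: ltnW.
rewrite coef_trunc1; last exact: leq_trans (leq_div _ _) le_iM.
case: i le_iM => [|[|i]] le_iM /=.
- by rewrite dvdn0 div0n mul0r mulr0 !addr0.
- by rewrite dvdn1 gtn_eqF // mul1r mulr1 add0r addr0.
rewrite mul0r mulr0 !addr0 add0r; case: ifP => // /dvdnP [[|j] E]; first by rewrite mul0n in E.
by rewrite E mulnK // ltnW.
Qed.

Section Growth.
Context {R : realFieldType} {K : fieldType} {nrm : K -> R}.
Hypothesis Hn : ultranorm nrm.
Variable p : nat.
Hypothesis p_pr : prime p.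
Hypothesis nrm_p : nrm p%:R = p%:R^-1.
Variable q : R.
Hypotheses (q_gt1 : 1 < q) (q_p : q ^+ p.-1 = p%:R).
Variables (c : K) (a : nat -> K) (d N : nat).
Hypotheses (d_gt1 : (1 < d)%N) (p_d : (p %| d)%N).
Hypothesis a_phi : is_phi_seq d c a.

(** This is the d^i-th power of the radius r_i contributed by E_i. *)
Let B i : R := nrm c / nrm (d ^ i.+1)%:R * q.

(** Here r is r_N, and theta < r dominates all the other r_i. The inequality r <= theta^d makes even
    F(x^(d^(i+1))) grow no faster than theta. *)
Variables (r theta : R).
Hypothesis r_B : r ^+ (d ^ N) = B N.
Hypotheses (theta_ge1 : 1 <= theta) (theta_lt : theta < r).
Hypothesis theta_B : forall i, i != N -> B i <= theta ^+ (d ^ i).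
Hypothesis r_theta : r <= theta ^+ d.

Let d_gt0 : (0 < d)%N. Proof. exact: ltnW. Qed.
Let di_gt0 i : (0 < d ^ i)%N. Proof. by rewrite expn_gt0 d_gt0. Qed.
Let p_di i : (p %| d ^ i.+1)%N. Proof. by rewrite expnS dvdn_mulr. Qed.
Let q_gt0 : 0 < q. Proof. exact: lt_trans q_gt1. Qed.
Let r_gt1 : 1 < r. Proof. exact: le_lt_trans theta_lt. Qed.
Let r_gt0 : 0 < r. Proof. exact: lt_trans r_gt1. Qed.
Let theta_gt0 : 0 < theta. Proof. exact: lt_le_trans theta_ge1. Qed.
Let B_ge0 i : 0 <= B i.
Proof. by rewrite !mulr_ge0 ?invr_ge0 ?unrm_ge0 // ltW. Qed.
Let qV_le1 : q^-1 <= 1. Proof. by rewrite invf_le1 // ltW. Qed.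

Let rbin_le i k : nrm (rbin c (d ^ i.+1) k) <= B i ^+ k.
Proof.
have [->|k0] := posnP k; first by rewrite expr0 (unrm1 Hn).
apply: le_trans (unrm_rbin_le Hn p_pr nrm_p (ltW q_gt1) q_p _ (p_di i) k0) _.
by rewrite -/(B i) ler_piMl ?exprn_ge0.
Qed.

(** The first entry is the room left by E_N, through Legendre's bound; the second is the room left
    by the other factors. *)
Definition growth_gap : R := Num.max q^-1 (theta / r).

Lemma growth_gap_gt0 : 0 < growth_gap.
Proof. by rewrite /growth_gap lt_max invr_gt0 q_gt0. Qed.

Lemma growth_gap_lt1 : growth_gap < 1.
Proof. by rewrite gt_max invf_lt1 // q_gt1 ltr_pdivrMr // mul1r. Qed.

Let w := eta_weight growth_gap r.

Let Hw : weight w.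
Proof. by apply: weight_eta; rewrite ?ltW ?growth_gap_gt0 ?growth_gap_lt1. Qed.

Let Ht : weight (fun i => theta ^+ i). Proof. by apply: weight_exp; apply: ltW. Qed.

Let rbin_gap i k : nrm (rbin c (d ^ i.+1) k) <= w (d ^ i * k)%N.
Proof.
have [->|k0] := posnP k; first by rewrite muln0 (unrm1 Hn).
have m0 : (0 < d ^ i * k)%N by rewrite muln_gt0 di_gt0.
have -> : w (d ^ i * k)%N = growth_gap * r ^+ (d ^ i * k) by case: (d ^ i * k)%N m0.
have [->|iN] := eqVneq i N.
  apply: le_trans (unrm_rbin_le Hn p_pr nrm_p (ltW q_gt1) q_p _ (p_di N) k0) _.
  rewrite -/(B N) -r_B -exprM ler_wpM2r ?exprn_ge0 ?(ltW r_gt0) //.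
  by rewrite le_max lexx.
apply: le_trans (rbin_le i k) _.
apply: (@le_trans _ _ (theta ^+ (d ^ i * k))).
  by rewrite exprM lerXn2r ?nnegrE ?theta_B ?B_ge0 ?exprn_ge0 ?ltW.
apply: (@le_trans _ _ (theta / r * r ^+ (d ^ i * k))); last first.
  by rewrite ler_wpM2r ?exprn_ge0 ?(ltW r_gt0) // le_max lexx orbT.
case: (d ^ i * k)%N m0 => // m _; rewrite !exprS mulrA mulfVK ?gt_eqF //.
by rewrite ler_wpM2l ?lerXn2r ?nnegrE ?(ltW theta_gt0) ?(ltW r_gt0) ?(ltW theta_lt).
Qed.

Let K0 m : (0 < m)%N -> m%:R != 0 :> K.
Proof. exact: (unrm_natr_neq0 Hn p_pr nrm_p). Qed.

Let trunc0 M : (trunc1 a M)`_0 = 1. Proof. by rewrite coef_trunc1. Qed.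

(** Induction on the precision: a bound on F in degrees up to M bounds every factor in degrees up to
    M+1, and F is the product of the factors. *)
Lemma ser1_gap n : nrm (ser1 a n) <= eta_weight growth_gap r n.
Proof.
suff H M : bdd nrm w M.+1 (trunc1 a M) by have := H n n (ltnSn n); rewrite coef_trunc1.
elim: M => [|M IHM].
  by apply/(bdd_trunc1 _ _ _ (leqnn _)) => -[|i] // _; rewrite (unrm1 Hn).
have HF : bdd nrm w M.+1 (trunc1 a M.+1).
  by apply: bdd_eqm IHM; apply/eqm_sym/eqm_trunc1.
apply: bdd_eqm (eqm_sym (binfac_prod K0 d_gt1 (trunc0 _) (trunc1_phi _ d_gt1 a_phi))) _.
apply: bdd_prod => // i _; apply: (bdd_binfac Hn Hw Hw d_gt0) => // j.
case: j => [|j]; first by rewrite muln0.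
have m0 : (0 < d ^ i.+1 * j.+1)%N by rewrite muln_gt0 di_gt0.
rewrite /w /=; case E : (d ^ i.+1 * j.+1)%N m0 => [|m] // _ /=.
rewrite ler_wpM2l ?(ltW growth_gap_gt0) // ler_weXn2l ?(ltW r_gt1) // -E.
by rewrite leq_pmull.
Qed.

Lemma ser1_le n : nrm (ser1 a n) <= r ^+ n.
Proof.
apply: le_trans (ser1_gap n) _; case: n => [|n] //=.
by rewrite ler_piMl ?exprn_ge0 ?ltW ?growth_gap_lt1.
Qed.

Hypothesis q_B : q < B N ^+ d.-1.

(** With k = p^t, the k-th binomial term alone has the stated size. A term j < k contributes only if
    k - j = l d, and is then at most B_N^(j+l). This falls short of B_N^k by B_N^(l (d-1)), which
    exceeds q by [q_B]. *)
Lemma binfac_lead (t : nat) (M := (d ^ N * p ^ t)%N) :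
  nrm (binfac c d M (trunc1 a M) N)`_M = q^-1 * r ^+ M.
Proof.
set k := (p ^ t)%N in M *; have k0 : (0 < k)%N by rewrite expn_gt0 prime_gt0.
have le_kM : (k <= M)%N by rewrite leq_pmull.
have lead : nrm (rbin c (d ^ N.+1) k) = q^-1 * r ^+ M.
  by rewrite (unrm_rbin_pexp Hn p_pr nrm_p (ltW q_gt1) q_p) // -/(B N) -r_B -exprM.
rewrite -lead; apply: (unrm_eq Hn); rewrite lead.
rewrite /binfac; set W := trunc_inv _ _; set V := W \Po _.
rewrite poly_def raddf_sum /= coef_sum.
have kM : (k < M.+1)%N by rewrite ltnS.
have Hr : weight (fun i => r ^+ i) by apply: weight_exp; apply: ltW.
have HW : bdd nrm (fun i => r ^+ i) M W.
  apply: bdd_trunc_inv => //; apply/bdd_trunc1; first exact: leqnSn.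
  by move=> i _; apply: ser1_le.
have W0 : W`_0 = 1 by apply: trunc_inv0.
have coefE (j : nat) : (rbin c (d ^ N.+1) j *: 'X^j \Po ('X^(d ^ N) * V))`_M =
    if (j <= k)%N then rbin c (d ^ N.+1) j *
      (if (d %| k - j)%N then (W ^+ j)`_((k - j) %/ d) else 0) else 0.
  rewrite comp_polyZ comp_Xn_poly coefZ exprMn -exprM coefXnM /M ltn_pmul2l //.
  case: leqP => [le_jk|]; last by rewrite mulr0.
  congr (_ * _); rewrite -mulnBr -(rmorphXn (comp_poly _)) /= coef_comp_poly_Xn //.
  by rewrite expnSr dvdn_pmul2l // divnMl.
rewrite (bigD1 (Ordinal kM)) //= coefE leqnn subnn dvdn0 div0n.
rewrite -horner_coef0 horner_exp horner_coef0 W0 expr1n mulr1 addrAC subrr add0r.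
apply: (unrm_sum_lt Hn) => [|j neq_jk].
  by rewrite mulr_gt0 ?invr_gt0 ?exprn_gt0.
rewrite coefE; have {neq_jk} neq_jk : (j : nat) != k by [].
have pos : 0 < q^-1 * r ^+ M by rewrite mulr_gt0 ?invr_gt0 ?exprn_gt0.
case: leqP => [le_jk|]; last by rewrite unrm0.
case: ifP => [/dvdnP [l El]|]; last by rewrite mulr0 unrm0.
have l0 : (0 < l)%N.
  rewrite lt0n; apply: contra neq_jk => /eqP l0.
  by rewrite eqn_leq le_jk -subn_eq0 El l0.
have B_gt1 : 1 < B N by rewrite -r_B exprn_egt1 // -lt0n di_gt0.
(* The bound on [W] covers only degrees below M; here l < l d = k - j <= M. *)
have lt_lM : (l < M)%N.
  apply: leq_trans le_kM; apply: leq_trans (leq_subr j k); rewrite El.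
  by rewrite -[X in (X < _)%N]muln1 ltn_pmul2l.
rewrite El mulnK // unrmM //.
apply: (@le_lt_trans _ _ (B N ^+ j * B N ^+ l)).
  rewrite ler_pM ?unrm_ge0 ?rbin_le //.
  apply: le_trans (bddX Hn Hr j HW lt_lM) _.
  rewrite -r_B lerXn2r ?nnegrE ?exprn_ge0 ?(ltW r_gt0) //.
  by rewrite -[X in X <= _]expr1 ler_weXn2l ?(ltW r_gt1).
rewrite [q^-1 * _]mulrC ltr_pdivlMr // (exprM r) r_B.
have -> : k = (j + l * d)%N by rewrite -El subnKC.
rewrite -(prednK d_gt0) mulnS addnA -exprD [X in _ < X]exprD.
rewrite ltr_pM2l ?exprn_gt0 ?(lt_trans _ B_gt1) //.
apply: lt_le_trans q_B _; rewrite ler_weXn2l ?(ltW B_gt1) //.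
by rewrite leq_pmull.
Qed.

(* Dividing F by the factors of index i <> N, whose coefficients grow at most
   like theta ^ n, transfers the growth of the N-th factor to F. *)
Lemma ser1_growth (C s : R) t (M := (d ^ N * p ^ t)%N) : theta <= s ->
  (forall n, nrm (ser1 a n) <= C * s ^+ n) -> q^-1 * r ^+ M <= C * s ^+ M.
Proof.
move=> le_s Ha; have s0 : 0 < s by apply: lt_le_trans le_s.
have C0 : 0 <= C by have := Ha 0%N; rewrite /= (unrm1 Hn) expr0 mulr1; apply: le_trans.
set F := trunc1 a M.
(* This places E_N among the M+1 factors of the product. *)
have NM : (N < M.+1)%N.
  rewrite ltnS ltnW // (leq_trans (ltn_expl N d_gt1)) // leq_pmulr //.
  by rewrite expn_gt0 prime_gt0.
pose P := \prod_(i < M.+1 | i != Ordinal NM) binfac c d M F i.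
have HF : eqm M.+1 F (binfac c d M F N * P).
  have := binfac_prod K0 d_gt1 (trunc0 _) (trunc1_phi M d_gt1 a_phi).
  by rewrite (bigD1 (Ordinal NM)).
have P0 : P`_0 = 1.
  rewrite -horner_coef0 horner_prod big1 // => i _.
  by rewrite horner_coef0 binfac0.
have HP : bdd nrm (fun i => theta ^+ i) M.+1 P.
  apply: bdd_prod => // i iN; apply: (bdd_binfac Hn (w' := fun i => r ^+ i) Ht _ d_gt0).
  - by apply: weight_exp; apply: ltW.
  - by apply/bdd_trunc1 => [|n _]; [exact: leqnSn | exact: ser1_le].
  - move=> j; rewrite (exprM theta) lerXn2r ?nnegrE ?exprn_ge0 ?(ltW r_gt0) ?(ltW theta_gt0) //.
    apply: le_trans r_theta _; rewrite ler_weXn2l //.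
    by rewrite -[X in (X <= _)%N]expn1 leq_pexp2l.
  move=> k; apply: le_trans (rbin_le i k) _.
  rewrite exprM lerXn2r ?nnegrE ?exprn_ge0 ?B_ge0 ?(ltW theta_gt0) //.
  exact: theta_B.
have HE : eqm M.+1 (F * trunc_inv M.+1 P) (binfac c d M F N).
  apply: eqm_trans (eqmM HF (eqm_refl _ _)) _; rewrite -mulrA.
  by have := eqmMl (binfac c d M F N) (trunc_invP M.+1 P0); rewrite mulr1.
have /eqmP/(_ M (ltnSn M)) E := HE.
(* E_N is F divided by the other factors: each term of the convolution is at most C s^i theta^(M-i),
   and theta <= s. *)
rewrite -binfac_lead -/M -/F -E coefM; apply: unrm_sum_le => // [|i _].
  by rewrite mulr_ge0 ?exprn_ge0 ?(ltW s0).
have le_iM : (i <= M)%N by rewrite -ltnS.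
rewrite unrmM // -[X in s ^+ X](subnKC le_iM) exprD mulrA ler_pM ?unrm_ge0 //.
  by rewrite coef_trunc1.
apply: le_trans (bdd_trunc_inv Hn Ht M.+1 HP _) _; first by rewrite ltnS leq_subr.
by rewrite lerXn2r ?nnegrE ?(ltW theta_gt0) ?(ltW s0).
Qed.

End Growth.

(** * The inverse series *)

Section Inverse.
Context {R : realFieldType} {K : fieldType} {nrm : K -> R}.
Hypothesis Hn : ultranorm nrm.
Variable w : nat -> R.
Hypothesis Hw : weight w.
Implicit Types f g u : {poly K}.

Lemma bdd_dropcoef M g : bdd nrm w M g -> bdd nrm w M.+1 (g - g`_M *: 'X^M).
Proof.
move=> Hg i; rewrite ltnS leq_eqVlt coefB coefZ coefXn => /orP [/eqP ->|lt_iM].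
  by rewrite eqxx mulr1 subrr unrm0 //; case: Hw.
by rewrite (ltn_eqF lt_iM) mulr0 subr0 Hg.
Qed.

Lemma bdd_addcoef M g : bdd nrm w M g -> nrm g`_M <= w M -> bdd nrm w M.+1 g.
Proof. by move=> Hg HM i; rewrite ltnS leq_eqVlt => /orP [/eqP -> //|/Hg]. Qed.

(* [f] has constant term 1, so the coefficient of X^M in [g f] determines that
   of [g] once the lower ones are known. *)
Lemma bdd_div M f g : f`_0 = 1 -> bdd nrm w M.+1 f -> bdd nrm w M g ->
  nrm (g * f)`_M <= w M -> bdd nrm w M.+1 g.
Proof.
move=> f0 Hf Hg HM; apply: (bdd_addcoef Hg).
have -> : g`_M = (g * f)`_M - ((g - g`_M *: 'X^M) * f)`_M.
  by rewrite mulrBl coefB opprB addrC subrK -scalerAl coefZ coefXnM ltnn subnn f0 mulr1.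
by apply: (unrmB_le Hn) => //; apply: (bddM Hn Hw _ Hf) (ltnSn M); apply: bdd_dropcoef.
Qed.

(** The top term of [g] contributes exactly its coefficient, as [u] and [f] have constant term 1.
    The remainder is controlled by [bdd_comp], which needs [u] only below degree M. *)
Lemma bdd_comp_div M f g u : f`_0 = 1 -> u`_0 = 1 -> bdd nrm w M.+1 f -> bdd nrm w M u ->
  bdd nrm w M g -> nrm ((g \Po ('X * u)) * f)`_M <= w M -> bdd nrm w M.+1 g.
Proof.
move=> f0 u0 Hf Hu Hg HM; apply: (bdd_addcoef Hg).
set g' := g - g`_M *: 'X^M.
have -> : g`_M = ((g \Po ('X * u)) * f)`_M - ((g' \Po ('X * u)) * f)`_M.
  rewrite -coefB -mulrBl -comp_polyB /g' opprB addrC subrK comp_polyZ comp_Xn_poly.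
  rewrite -scalerAl coefZ exprMn -mulrA coefXnM ltnn subnn coef0M f0 mulr1.
  by rewrite -horner_coef0 horner_exp horner_coef0 u0 expr1n mulr1.
apply: (unrmB_le Hn) => //; apply: (bddM Hn Hw _ Hf) (ltnSn M).
rewrite -['X]expr1; apply: (bdd_comp Hn Hw) => // k le_kM.
by rewrite mul1n; apply: bdd_dropcoef.
Qed.

Variables (d : nat) (a a' : nat -> K).
Hypothesis inv_a : is_inverse_seq d a a'.

Let trunc0 (g : nat -> K) M : (trunc1 g M)`_0 = 1. Proof. by rewrite coef_trunc1. Qed.

Let trunc_exp0 (g : nat -> K) M k : (trunc1 g M ^+ k)`_0 = 1.
Proof. by rewrite -horner_coef0 horner_exp horner_coef0 trunc0 expr1n. Qed.

Let delta_le M : nrm (M == 0%N)%:R <= w M.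
Proof.
by case: Hw => w0 wge _; case: M => [|M]; rewrite ?w0 ?(unrm1 Hn) ?(unrm0 Hn).
Qed.

Let bdd_trunc_step (g : nat -> K) M :
  bdd nrm w M.+1 (trunc1 g M) -> bdd nrm w M.+1 (trunc1 g M.+1).
Proof. by move=> H; apply: bdd_eqm H; apply/eqm_sym/eqm_trunc1. Qed.

Let bdd_trunc_base (g : nat -> K) : bdd nrm w 1 (trunc1 g 0).
Proof. by apply/bdd_trunc1 => // -[|i] // _; rewrite (unrm1 Hn); case: Hw => ->. Qed.

Let bdd_trunc_ser (g : nat -> K) :
  (forall n, nrm (ser1 g n) <= w n) <-> (forall M, bdd nrm w M.+1 (trunc1 g M)).
Proof.
split=> H n; first exact/bdd_trunc1.
by have := H n n (ltnSn n); rewrite coef_trunc1.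
Qed.

(** The bound passes first to F^(-d) and then to the inverse series, degree by degree. *)
Lemma inverse_le : (forall n, nrm (ser1 a n) <= w n) -> forall n, nrm (ser1 a' n) <= w n.
Proof.
case: inv_a => v [Hv Ha'] /bdd_trunc_ser Ha; apply/bdd_trunc_ser.
have Bv M : bdd nrm w M.+1 (trunc1 v M).
  elim: M => [|M IHM]; first exact: bdd_trunc_base.
  apply: (bdd_div (trunc_exp0 a M.+1 d)); last by rewrite Hv.
    exact: bddX.
  exact: bdd_trunc_step.
elim=> [|M IHM]; first exact: bdd_trunc_base.
apply: (bdd_comp_div (trunc0 a M.+1) (trunc0 v M.+1) (Ha _)); last by rewrite Ha'.
  exact: bdd_trunc_step.
exact: bdd_trunc_step.
Qed.

(** F and W = F^(-d) are bounded together: in F(x) G(x W(x)) = 1 the factor x delays W by one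
    degree, so the next coefficient of F comes first and that of W follows. *)
Lemma inverse_ge : (forall n, nrm (ser1 a' n) <= w n) -> forall n, nrm (ser1 a n) <= w n.
Proof.
case: inv_a => v [Hv Ha'] /bdd_trunc_ser Ba'; apply/bdd_trunc_ser.
suff H M : bdd nrm w M.+1 (trunc1 a M) /\ bdd nrm w M.+1 (trunc1 v M) by move=> M; case: (H M).
elim: M => [|M [IHa IHv]]; first by split; apply: bdd_trunc_base.
have Ba : bdd nrm w M.+2 (trunc1 a M.+1).
  apply: (@bdd_div _ (trunc1 a' M.+1 \Po ('X * trunc1 v M.+1))).
  - rewrite -horner_coef0 horner_comp hornerM hornerX mul0r horner_coef0.
    exact: trunc0.
  - rewrite -['X]expr1; apply: (bdd_comp Hn Hw) => // [k le_k|].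
      by rewrite mul1n; apply: Ba'.
    exact: bdd_trunc_step.
  - exact: bdd_trunc_step.
  by rewrite mulrC Ha'.
split=> //; apply: (bdd_div (trunc_exp0 a M.+1 d)); last by rewrite Hv.
  exact: bddX.
exact: bdd_trunc_step.
Qed.

End Inverse.

(** * Radii *)

Section RealLemmas.
Variable R : realType.
Implicit Types r s x theta : R.

Lemma powR_root x n : 0 <= x -> (0 < n)%N -> (x `^ n%:R^-1) ^+ n = x.
Proof.
move=> x0 n0; rewrite -powR_mulrn ?powR_ge0 // -powRrM mulVf ?powRr1 //.
by rewrite pnatr_eq0 -lt0n.
Qed.

Lemma powR_expK x n : 0 <= x -> (0 < n)%N -> (x ^+ n) `^ n%:R^-1 = x.
Proof.
move=> x0 n0; rewrite -powR_mulrn // -powRrM mulfV ?powRr1 //.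
by rewrite pnatr_eq0 -lt0n.
Qed.

Lemma exp_lt_between s r x n : 0 <= s -> s < r -> (0 < n)%N -> x < r ^+ n ->
  exists theta, [/\ s <= theta, theta < r & x <= theta ^+ n].
Proof.
(* Replacing x by its maximum with 0 makes the n-th root available for every real x. *)
move=> s0 lt_sr n0 lt_x; pose y := Num.max x 0.
have y0 : 0 <= y by rewrite le_max lexx orbT.
have lt_y : y < r ^+ n by rewrite gt_max lt_x exprn_gt0 // (le_lt_trans s0).
have rt0 : 0 <= y `^ n%:R^-1 by apply: powR_ge0.
exists (Num.max s (y `^ n%:R^-1)); split.
- by rewrite le_max lexx.
- rewrite gt_max lt_sr /= ltNge; apply/negP => le_r.
  have : r ^+ n <= y.
    by rewrite -(powR_root y0 n0) lerXn2r ?nnegrE // ltW // (le_lt_trans s0).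
  by rewrite leNgt lt_y.
apply: (@le_trans _ _ y); first by rewrite le_max lexx.
rewrite -[X in X <= _](powR_root y0 n0) lerXn2r ?nnegrE ?le_max ?rt0 ?orbT //.
by rewrite lexx orbT.
Qed.

Lemma exp_dominates s r (C : R) : 0 < s -> s < r ->
  exists n0, forall n, (n0 <= n)%N -> C * s ^+ n < r ^+ n.
Proof.
move=> s0 lt_sr; pose e := r / s - 1.
have e0 : 0 < e by rewrite subr_gt0 ltr_pdivlMr // mul1r.
have bern n : 1 + e * n%:R <= (1 + e) ^+ n.
  elim: n => [|n IHn]; first by rewrite mulr0 addr0.
  rewrite exprS -natr1; apply: le_trans (_ : (1 + e) * (1 + e * n%:R) <= _).
    have : 0 <= e * e * n%:R by rewrite !mulr_ge0 ?ler0n ?ltW.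
    by lra.
  by rewrite ler_wpM2l // addr_ge0 // ltW.
exists (Num.bound (`|C| / e)) => n le_n.
have re : r = (1 + e) * s by rewrite /e addrC subrK mulfVK // gt_eqF.
rewrite re exprMn ltr_pM2r ?exprn_gt0 //; apply: lt_le_trans (bern n).
apply: (@le_lt_trans _ _ `|C|); first exact: ler_norm.
have : `|C| / e < n%:R.
  by apply: lt_le_trans (archi_boundP _) _; rewrite ?ler_nat // divr_ge0 ?(ltW e0).
by rewrite ltr_pdivrMr // mulrC => H; apply: lt_trans H _; rewrite ltrDr ltr01.
Qed.

(** With r_i^(d^i) = beta delta^i, the last two hypotheses say r_(N+1) < r_N and r_(N-1) < r_N.
    Three successive enlargements fit theta to r <= theta^d and to these two neighbours; the other
    indices follow by propagation. *)
Lemma theta_exists (beta delta r : R) d N : (1 < d)%N -> 0 < beta -> 1 < delta -> 1 < r ->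
    r ^+ (d ^ N) = beta * delta ^+ N -> delta < (beta * delta ^+ N) ^+ d.-1 ->
    ((0 < N)%N -> (beta * delta ^+ N.-1) ^+ d.-1 < delta) ->
  exists theta, [/\ 1 <= theta, theta < r,
    forall i, i != N -> beta * delta ^+ i <= theta ^+ (d ^ i) & r <= theta ^+ d].
Proof.
move=> d1 b0 dl1 r1 rB up low; have d0 : (0 < d)%N by apply: ltnW.
have dl0 : 0 < delta by apply: lt_trans dl1.
have r0 : 0 < r by apply: lt_trans r1.
have di i : (0 < d ^ i)%N by rewrite expn_gt0 d0.
have B0 i : 0 < beta * delta ^+ i by rewrite mulr_gt0 ?exprn_gt0.
have expd (x : R) : x ^+ d = x * x ^+ d.-1 by rewrite -exprS prednK.
have [t1 [le_t1 lt_t1 rt1]] : exists theta, [/\ 1 <= theta, theta < r & r <= theta ^+ d].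
  by apply: exp_lt_between => //; rewrite -[X in X < _]expr1 ltr_eXn2l.
have t1_0 : 0 <= t1 by apply: le_trans le_t1.
have [t2 [le_t2 lt_t2 Bt2]] : exists theta,
    [/\ t1 <= theta, theta < r & beta * delta ^+ N.+1 <= theta ^+ (d ^ N.+1)].
  apply: exp_lt_between => //; rewrite expnSr exprM rB expd exprSr mulrA.
  by rewrite ltr_pM2l.
have t2_0 : 0 <= t2 by apply: le_trans le_t2.
have [t [le_t lt_t Bt]] : exists theta,
    [/\ t2 <= theta, theta < r & (0 < N)%N -> beta * delta ^+ N.-1 <= theta ^+ (d ^ N.-1)].
  have [N0|N0] := posnP N; first by exists t2; split => //; rewrite N0.
  have [|t [h1 h2 h3]] := @exp_lt_between t2 r (beta * delta ^+ N.-1) (d ^ N.-1) t2_0 lt_t2 (di _).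
    rewrite -(ltr_pXn2r d0) ?nnegrE ?exprn_ge0 ?(ltW (B0 _)) ?(ltW r0) //.
    rewrite -exprM -expnSr prednK // rB expd -[in X in _ < X](prednK N0) exprSr mulrA.
    by rewrite ltr_pM2l // low.
  by exists t.
have t_ge1 : 1 <= t by apply: le_trans le_t; apply: le_trans le_t2.
have t0 : 0 < t by apply: lt_le_trans t_ge1.
(* From t^(d^N) delta <= r^(d^N) delta = beta delta^(N+1) <= t^(d^(N+1)). Raising the index beyond
   N+1 multiplies the left side by delta and the right side by at least as much. *)
have dl_t : delta <= t ^+ (d ^ N * d.-1).
  rewrite -(@ler_pM2l _ (t ^+ (d ^ N))) ?exprn_gt0 // -exprD -mulnS prednK // -expnSr.
  apply: le_trans (_ : beta * delta ^+ N.+1 <= _).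
    by rewrite exprSr mulrA -rB ler_wpM2r ?(ltW dl0) // lerXn2r ?nnegrE ?ltW.
  by apply: le_trans Bt2 _; rewrite lerXn2r ?nnegrE ?(ltW t0).
have upB j : beta * delta ^+ (N.+1 + j) <= t ^+ (d ^ (N.+1 + j)).
  elim: j => [|j IHj].
    by rewrite addn0; apply: le_trans Bt2 _; rewrite lerXn2r ?nnegrE ?(ltW t0).
  rewrite addnS exprSr mulrA expnSr -{2}(prednK d0) mulnS [X in _ <= X]exprD.
  rewrite ler_pM ?(ltW (B0 _)) ?(ltW dl0) //; apply: le_trans dl_t _.
  by rewrite ler_weXn2l // leq_mul2r leq_pexp2l ?orbT // addSnnS leq_addr.
(* Downwards, [low] persists because beta delta^i increases with i; it turns the d-th power of one
   term into at most the next term. *)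
have downB j : (j < N)%N -> beta * delta ^+ (N.-1 - j) <= t ^+ (d ^ (N.-1 - j)).
  move=> lt_j; have N0 : (0 < N)%N by apply: leq_ltn_trans lt_j.
  elim: j lt_j => [|j IHj] lt_j; first by rewrite subn0 Bt.
  set m := (N.-1 - j.+1)%N.
  have lt_jN : (j < N.-1)%N by rewrite -ltnS prednK.
  have := IHj (ltnW lt_j); rewrite -(subnSK lt_jN) -/m => IH.
  rewrite -(ler_pXn2r d0) ?nnegrE ?exprn_ge0 ?(ltW t0) ?(ltW (B0 _)) //.
  rewrite -exprM -expnSr; apply: le_trans IH; rewrite expd exprSr mulrA.
  rewrite ler_wpM2l ?(ltW (B0 _)) //; apply: le_trans (ltW (low N0)).
  rewrite lerXn2r ?nnegrE ?(ltW (B0 _)) // ler_wpM2l ?(ltW b0) //.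
  by rewrite ler_weXn2l ?(ltW dl1) // /m leq_subr.
exists t; split => //.
- move=> i; rewrite neq_ltn => /orP [lt_i|lt_i].
    have N0 : (0 < N)%N by apply: leq_ltn_trans lt_i.
    have le_i : (i <= N.-1)%N by rewrite -ltnS prednK.
    rewrite -(subKn le_i); apply: downB.
    by apply: leq_ltn_trans (leq_subr _ _) _; rewrite ltn_predL.
  by rewrite -(subnKC lt_i); apply: upB.
apply: le_trans rt1 _; rewrite lerXn2r ?nnegrE ?(ltW t0) //.
exact: le_trans le_t2 le_t.
Qed.

End RealLemmas.

Section Radius.
Context {R : realType} {K : fieldType} {nrm : K -> R}.
Hypothesis Hn : ultranorm nrm.

Lemma rad_powE (g : nat -> K) (r : R) : 0 < r ->
    (forall n, nrm (ser1 g n) <= r ^+ n) ->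
    (forall (s : R) n0, 0 < s -> s < r -> ~ (forall n, (n0 <= n)%N -> nrm (ser1 g n) <= s ^+ n)) ->
  rad_pow nrm g = r%:E.
Proof.
move=> r0 up low; rewrite /rad_pow limn_esup_lim.
set u := fun n => _; have -> : limn (esups u) = ereal_inf (range (esups u)).
  exact/cvg_lim/cvg_esups_inf.
have ser1E n : (0 < n)%N -> ser1 g n = g n by case: n.
apply/eqP; rewrite eq_le; apply/andP; split.
  (* Index 0 is skipped: there the exponent is [0^-1 = 0], and [ser1] ignores [g 0]. *)
  apply: (@le_trans _ _ (esups u 1%N)); first by apply: ereal_inf_lbound; exists 1%N.
  apply: ge_ereal_sup => _ [n /= n1 <-]; rewrite lee_fin -(powR_expK (ltW r0) n1).
  rewrite ge0_ler_powR ?nnegrE ?invr_ge0 ?ler0n ?exprn_ge0 ?unrm_ge0 ?(ltW r0) //.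
  by rewrite -ser1E.
apply: le_ereal_inf_tmp => _ [n _ <-]; rewrite leNgt; apply/negP => lt_r.
(* The midpoint between the supremum and r is positive even when the supremum is 0. *)
have [s [s0 sr es]] : exists s : R, [/\ 0 < s, s < r & (esups u n <= s%:E)%E].
  have : (0 <= esups u n)%E.
    apply: (@le_trans _ _ (u n)); first by rewrite lee_fin powR_ge0.
    by apply: ereal_sup_ubound; exists n => //=.
  case: (esups u n) lt_r => [x| |] //; rewrite lte_fin lee_fin => x_r x0.
  by exists ((x + r) / 2); split; rewrite ?lee_fin; lra.
apply: (low s n.+1 s0 sr) => k lt_nk; have k0 : (0 < k)%N by apply: leq_ltn_trans lt_nk.
rewrite ser1E // -(powR_root (unrm_ge0 Hn (g k)) k0) lerXn2r ?nnegrE ?powR_ge0 ?(ltW s0) //.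
rewrite -lee_fin; apply: le_trans es; apply: ereal_sup_ubound; exists k => //=.
exact: ltnW.
Qed.

(* Finitely many strict inequalities leave room for a smaller radius. *)
Lemma radius_shrink (g : nat -> K) (eta r s : R) n0 : 0 < eta -> eta < 1 ->
    (forall n, nrm (ser1 g n) <= eta_weight eta r n) -> 0 < s -> s < r ->
    (forall n, (n0 <= n)%N -> nrm (ser1 g n) <= s ^+ n) ->
  exists2 s', s <= s' < r & forall n, nrm (ser1 g n) <= s' ^+ n.
Proof.
move=> e0 e1 H s0 sr Hs; have r0 : 0 < r by apply: lt_trans sr.
(* As s' < r, the inequality eta r^(n0+1) <= s'^(n0+1) implies eta r^n <= s'^n for all n <= n0+1. *)
have [|s' [le_s lt_s es]] := @exp_lt_between R s r (eta * r ^+ n0.+1) n0.+1 (ltW s0) sr isT.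
  by rewrite gtr_pMl // exprn_gt0.
have s'0 : 0 < s' by apply: lt_le_trans le_s.
exists s' => [|n]; first by rewrite le_s.
case: (leqP n0 n) => [le_n|lt_n].
  by apply: le_trans (Hs n le_n) _; rewrite lerXn2r ?nnegrE ?(ltW s0) ?(ltW s'0).
case: n lt_n => [|n] lt_n; first by rewrite expr0 (unrm1 Hn).
apply: le_trans (H n.+1) _; rewrite /eta_weight.
have le_n : (n.+1 <= n0.+1)%N by apply: leq_trans (ltnW lt_n) (leqnSn _).
rewrite -(@ler_pM2r _ (s' ^+ (n0.+1 - n.+1))) ?exprn_gt0 //.
rewrite -[X in _ <= X]exprD subnKC //; apply: le_trans es.
rewrite -[X in _ <= _ * r ^+ X](subnKC le_n) exprD mulrA ler_wpM2l //.
  by rewrite mulr_ge0 ?exprn_ge0 ?(ltW e0) ?(ltW r0).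
by rewrite lerXn2r ?nnegrE ?(ltW s'0) ?(ltW r0) // ltW.
Qed.

End Radius.

(** * Convergence and isometry *)

Section Limits.
Context {R : realType} {K : fieldType} {nrm : K -> R}.
Hypothesis Hn : ultranorm nrm.
Implicit Types (u v : nat -> K) (C k : R).

Lemma geometric_small C k eps : 0 < k -> k < 1 -> 0 < eps ->
  exists n0, forall n, (n0 <= n)%N -> C * k ^+ n < eps.
Proof.
move=> k0 k1 e0; have [n0 H] := exp_dominates (C / eps) k0 k1; exists n0 => n /H.
by rewrite expr1n mulrAC ltr_pdivrMr // mul1r.
Qed.

Lemma cauchy_geometric u C k : 0 < k -> k < 1 ->
  (forall m, nrm (u m.+1 - u m) <= C * k ^+ m) -> cauchy_seq nrm u.
Proof.
move=> k0 k1 H eps e0; have [n0 small] := geometric_small C k0 k1 e0; exists n0.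
have tail n j : nrm (u (n + j)%N - u n) <= C * k ^+ n.
  elim: j => [|j IHj].
    by rewrite addn0 subrr (unrm0 Hn); apply: le_trans (H n); apply: unrm_ge0.
  rewrite addnS -(subrK (u (n + j)%N) (u _.+1)) -addrA; apply: (unrmD_le Hn) => //.
  apply: le_trans (H _) _; have C0 : 0 <= C.
    by have := le_trans (unrm_ge0 Hn _) (H 0%N); rewrite expr0 mulr1.
  by rewrite ler_wpM2l // exprD ler_piMr ?exprn_ge0 ?exprn_ile1 ?ltW.
have close m : (n0 <= m)%N -> nrm (u m - u n0) < eps.
  by move=> /subnKC <-; apply: le_lt_trans (tail _ _) (small _ (leqnn _)).
move=> m n /close Hm /close Hn'; rewrite -(subrK (u n0) (u m)) -addrA.
by apply: (unrmD_lt Hn) => //; rewrite unrmC.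
Qed.

Lemma converges_to_le u l x t : converges_to nrm u l ->
  (forall m, nrm (u m - x) <= t) -> nrm (l - x) <= t.
Proof.
move=> Hu Ht; rewrite leNgt; apply/negP => lt_t.
have [|m0 /(_ m0 (leqnn _)) H] := Hu (nrm (l - x)).
  by apply: le_lt_trans lt_t; apply: le_trans (Ht 0%N); apply: unrm_ge0.
suff : nrm (l - x) < nrm (l - x) by rewrite ltxx.
rewrite -{1}(subrK (u m0) l) -addrA; apply: (unrmD_lt Hn); first by rewrite unrmC.
exact: le_lt_trans (Ht m0) lt_t.
Qed.

Lemma converges_toB u v l l' : converges_to nrm u l -> converges_to nrm v l' ->
  converges_to nrm (fun m => u m - v m) (l - l').
Proof.
move=> Hu Hv eps e0; have [m0 H] := Hu _ e0; have [m1 H'] := Hv _ e0.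
exists (maxn m0 m1) => m; rewrite geq_max => /andP [/H h /H' h'].
have -> : u m - v m - (l - l') = (u m - l) - (v m - l') by ring.
by apply: (unrmD_lt Hn) => //; rewrite unrmN.
Qed.

End Limits.

Section Isometry.
Context {R : realType} {K : fieldType} {nrm : K -> R}.
Hypothesis Hn : ultranorm nrm.
Hypothesis complete : forall u, cauchy_seq nrm u -> exists l, converges_to nrm u l.
Variables (d : nat) (r : R) (g : nat -> K).
Hypotheses (d_gt0 : (0 < d)%N) (r_gt0 : 0 < r).
Hypothesis g_le : forall n, nrm (ser1 g n) <= r ^+ n.

Let ratio (z : K) : R := r / nrm z ^+ d.

Let neq0 z : r < nrm z ^+ d -> z != 0.
Proof.
apply: contraTneq => ->; rewrite (unrm0 Hn) expr0n.
by rewrite (gtn_eqF d_gt0) -leNgt ltW.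
Qed.

Let ratio_gt0 z : r < nrm z ^+ d -> 0 < ratio z.
Proof. by move=> H; rewrite divr_gt0 ?exprn_gt0 // (unrm_gt0 Hn) neq0. Qed.

Let ratio_lt1 z : r < nrm z ^+ d -> ratio z < 1.
Proof. by move=> H; rewrite ltr_pdivrMr ?mul1r // exprn_gt0 // (unrm_gt0 Hn) neq0. Qed.

Let partialE (z : K) m :
  partial_phi d g z m = z + \sum_(1 <= n < m.+1) g n * (z * (z ^+ (n * d))^-1).
Proof.
rewrite /partial_phi mulrDr mulr1 mulr_sumr; congr (_ + _).
by apply: eq_bigr => n _; rewrite mulrCA.
Qed.

Let coef_le n T k : (0 < n)%N -> 0 <= T -> r * T ^+ d <= k ->
  nrm (g n) * T ^+ (n * d) <= k ^+ n.
Proof.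
move=> n0 T0 H; apply: le_trans (_ : r ^+ n * T ^+ (n * d) <= _).
  by rewrite ler_wpM2r ?exprn_ge0 //; have := g_le n; case: (n) n0.
rewrite mulnC exprM -exprMn lerXn2r ?nnegrE ?mulr_ge0 ?exprn_ge0 ?(ltW r_gt0) //.
by apply: le_trans H; rewrite mulr_ge0 ?exprn_ge0 ?(ltW r_gt0).
Qed.

Let term_le z n : r < nrm z ^+ d -> (0 < n)%N ->
  nrm (g n * (z * (z ^+ (n * d))^-1)) <= nrm z * ratio z ^+ n.
Proof.
move=> Hz n0; rewrite !(unrmM Hn) (unrmV Hn) (unrmX Hn) mulrCA ler_wpM2l ?(unrm_ge0 Hn) //.
by rewrite -exprVn coef_le ?invr_ge0 ?(unrm_ge0 Hn) // exprVn.
Qed.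

Lemma partial_phi_cvg z : r < nrm z ^+ d ->
  exists y, converges_to nrm (partial_phi d g z) y.
Proof.
move=> Hz; apply/complete/(cauchy_geometric Hn (ratio_gt0 Hz) (ratio_lt1 Hz)
  (C := nrm z)) => m.
rewrite !partialE (big_nat_recr m.+1) //=; set S := bigop _ _ _; set t := g m.+1 * _.
have -> : z + (S + t) - (z + S) = t by ring.
apply: le_trans (term_le Hz _) _ => //; rewrite ler_wpM2l ?(unrm_ge0 Hn) //.
by rewrite exprS ler_piMl ?exprn_ge0 ?(ltW (ratio_gt0 Hz)) ?(ltW (ratio_lt1 Hz)).
Qed.

Let partial_self z m : r < nrm z ^+ d ->
  nrm (partial_phi d g z m - z) <= ratio z * nrm z.
Proof.
move=> Hz; rewrite partialE addrAC subrr add0r big_nat.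
apply: (unrm_sum_le Hn) => [|n /andP [n0 _]].
  by rewrite mulr_ge0 ?(unrm_ge0 Hn) ?(ltW (ratio_gt0 Hz)).
apply: le_trans (term_le Hz n0) _; rewrite mulrC ler_wpM2r ?(unrm_ge0 Hn) //.
case: n n0 => // n _; rewrite exprS ler_piMr ?(ltW (ratio_gt0 Hz)) //.
by rewrite exprn_ile1 ?(ltW (ratio_gt0 Hz)) ?(ltW (ratio_lt1 Hz)).
Qed.

(** The function compared is z^(-k). For k > 0, z^(-1) - w^(-1) = (w - z)/(z w) yields two factors
    T, and the remaining geometric sum T^(k-1). *)
Lemma inv_pow_diff_le (z w : K) (T : R) k : z != 0 -> w != 0 ->
  nrm z^-1 <= T -> nrm w^-1 <= T ->
  nrm (z * (z ^+ k.+1)^-1 - w * (w ^+ k.+1)^-1) <= nrm (z - w) * T ^+ k.+1.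
Proof.
move=> z0 w0 zT wT; have T0 : 0 <= T by apply: le_trans zT; apply: unrm_ge0.
rewrite !exprS !invfM !mulVKf // -!exprVn; case: k => [|k].
  by rewrite !expr0 subrr (unrm0 Hn) mulr_ge0 ?(unrm_ge0 Hn) ?mulr1.
rewrite subrXX /= (unrmM Hn) (_ : z^-1 - w^-1 = (w - z) * z^-1 * w^-1); last first.
  by field; rewrite z0 w0.
rewrite 2!(unrmM Hn) unrmC // !exprS -!mulrA !ler_pM ?mulr_ge0 ?(unrm_ge0 Hn) //.
apply: (unrm_sum_le Hn) => [|i _]; first exact: exprn_ge0.
have le_ik : (i <= k)%N by rewrite -ltnS.
rewrite (unrmM Hn) !(unrmX Hn) -[X in T ^+ X](subnK le_ik) exprD.
by rewrite ler_pM ?exprn_ge0 ?(unrm_ge0 Hn) // lerXn2r ?nnegrE ?(unrm_ge0 Hn).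
Qed.

(** The n-th term of phi(z) - z varies by at most k^n |z - w|, with k^n <= k. The bound is uniform
    in m and so survives in the limit. *)
Let partial_diff z w T k m : z != 0 -> w != 0 -> nrm z^-1 <= T -> nrm w^-1 <= T ->
  r * T ^+ d <= k -> k <= 1 ->
  nrm (partial_phi d g z m - partial_phi d g w m - (z - w)) <= k * nrm (z - w).
Proof.
move=> z0 w0 zT wT Tk k1; have T0 : 0 <= T by apply: le_trans zT; apply: unrm_ge0.
have k0 : 0 <= k by apply: le_trans Tk; rewrite mulr_ge0 ?exprn_ge0 ?(ltW r_gt0).
rewrite !partialE; set s1 := \sum_(_ <= _ < _) _; set s2 := \sum_(_ <= _ < _) _.
have -> : z + s1 - (w + s2) - (z - w) = s1 - s2 by ring.
rewrite -sumrB big_nat; apply: (unrm_sum_le Hn) => [|n /andP [n0 _]].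
  by rewrite mulr_ge0 ?(unrm_ge0 Hn).
rewrite -mulrBr (unrmM Hn).
apply: le_trans (_ : nrm (g n) * (nrm (z - w) * T ^+ (n * d)) <= _).
  rewrite ler_wpM2l ?(unrm_ge0 Hn) //; have : (0 < n * d)%N by rewrite muln_gt0 n0.
  by case: (n * d)%N => // j _; apply: inv_pow_diff_le.
rewrite mulrCA mulrC ler_wpM2r ?(unrm_ge0 Hn) //; apply: le_trans (coef_le n0 T0 Tk) _.
by case: n n0 => // n _; rewrite exprS ler_piMr // exprn_ile1.
Qed.

Variable f : K -> K.
Hypothesis f_lim : forall z, r < nrm z ^+ d -> converges_to nrm (partial_phi d g z) (f z).

Let f_diff z w T k : r < nrm z ^+ d -> r < nrm w ^+ d ->
  nrm z^-1 <= T -> nrm w^-1 <= T -> r * T ^+ d <= k -> k <= 1 ->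
  nrm (f z - f w - (z - w)) <= k * nrm (z - w).
Proof.
move=> Hz Hw zT wT Tk k1; apply: (converges_to_le Hn (converges_toB Hn (f_lim Hz) (f_lim Hw))).
by move=> m; apply: partial_diff Tk k1; rewrite ?neq0.
Qed.

Let f_self z : r < nrm z ^+ d -> nrm (f z - z) <= ratio z * nrm z.
Proof.
by move=> Hz; apply: (converges_to_le Hn (f_lim Hz)) => m; apply: partial_self.
Qed.

Lemma phi_norm z : r < nrm z ^+ d -> nrm (f z) = nrm z.
Proof.
move=> Hz; apply: (unrm_eq Hn); apply: le_lt_trans (f_self Hz) _.
by rewrite gtr_pMl ?ratio_lt1 // (unrm_gt0 Hn) neq0.
Qed.

Lemma phi_isometry z w : r < nrm z ^+ d -> r < nrm w ^+ d -> nrm (f z - f w) = nrm (z - w).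
Proof.
move=> Hz Hw; have [->|neq_zw] := eqVneq z w; first by rewrite !subrr.
pose T := Num.max (nrm z^-1) (nrm w^-1).
have T1 : r * T ^+ d < 1.
  by rewrite /T maxEle; case: ifP => _; rewrite (unrmV Hn) exprVn ratio_lt1.
apply: (unrm_eq Hn); apply: le_lt_trans (f_diff Hz Hw _ _ (lexx (r * T ^+ d)) (ltW T1)) _.
- by rewrite le_max lexx.
- by rewrite le_max lexx orbT.
by rewrite gtr_pMl // (unrm_gt0 Hn) subr_eq0.
Qed.

(* The map z |-> z + (y - f z) contracts the circle |z| = |y|. *)
Lemma phi_surjective y : r < nrm y ^+ d -> exists2 z, r < nrm z ^+ d & f z = y.
Proof.
move=> Hy; pose u m := iter m (fun z => z + (y - f z)) y; pose k := ratio y.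
have k0 : 0 < k by apply: ratio_gt0.
have k1 : k < 1 by apply: ratio_lt1.
have y0 : 0 < nrm y by rewrite (unrm_gt0 Hn) neq0.
have inD z : nrm z = nrm y -> r < nrm z ^+ d by move=> ->.
have step m : nrm (u m) = nrm y /\ nrm (y - f (u m)) <= nrm y * k ^+ m.+1.
  elim: m => [|m [IH1 IH2]]; first by split=> //=; rewrite (unrmC Hn) mulrC f_self.
  have uS : u m.+1 = u m + (y - f (u m)) by [].
  have nS : nrm (u m.+1) = nrm y.
    rewrite -IH1; apply: (unrm_eq Hn); rewrite uS addrAC subrr add0r IH1.
    apply: le_lt_trans IH2 _; rewrite gtr_pMr // exprn_ilt1 //; exact: ltW.
  (* Since y - f(u_m) is the last increment, the new error is the variation of f - id along it,
     smaller by the factor k. *)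
  split=> //; have -> : y - f (u m.+1) = - (f (u m.+1) - f (u m) - (u m.+1 - u m)).
    by rewrite uS; ring.
  rewrite (unrmN Hn).
  apply: le_trans (f_diff (T := (nrm y)^-1) (k := k) (inD _ nS) (inD _ IH1) _ _ _ (ltW k1)) _.
  - by rewrite (unrmV Hn) nS.
  - by rewrite (unrmV Hn) IH1.
  - by rewrite exprVn.
  by rewrite uS [u m + _ - _]addrAC subrr add0r exprS mulrCA ler_wpM2l // ltW.
have diffu m : nrm (u m.+1 - u m) <= (nrm y * k) * k ^+ m.
  rewrite (_ : u m.+1 - u m = y - f (u m)); first by rewrite -mulrA -exprS; case: (step m).
  by rewrite /u /= addrAC subrr add0r.
have [z Hz] := complete (cauchy_geometric Hn k0 k1 diffu).
have nz : nrm z = nrm y.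
  apply: (unrm_eq Hn); apply: (@le_lt_trans _ _ (nrm y * k)); last by rewrite gtr_pMr.
  apply: (converges_to_le Hn Hz) => m; elim: m => [|m IHm].
    by rewrite /= subrr (unrm0 Hn) mulr_ge0 ?ltW.
  rewrite -(subrK (u m) (u m.+1)) -addrA; apply: (unrmD_le Hn) IHm.
  apply: le_trans (diffu m) _; rewrite ler_piMr ?exprn_ile1 ?(ltW k0) ?(ltW k1) //.
  by rewrite mulr_ge0 ?ltW.
exists z; first exact: inD.
apply/eqP; rewrite -subr_eq0 -(unrm_eq0 Hn) eq_le (unrm_ge0 Hn) andbT leNgt; apply/negP => pos.
have [m1 H1] := Hz _ pos; have [m2 H2] := geometric_small (nrm y) k0 k1 pos.
pose m := maxn m1 m2; suff : nrm (f z - y) < nrm (f z - y) by rewrite ltxx.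
(* If f z were not y, f(u_m) would be closer than |f z - y| to both: to f z by the isometry, to y by
   the decay of the errors. *)
rewrite -{1}(subrK (f (u m)) (f z)) -addrA; apply: (unrmD_lt Hn).
  have [Hu _] := step m; rewrite phi_isometry ?inD // (unrmC Hn).
  by apply: H1; rewrite leq_maxl.
rewrite (unrmC Hn); case: (step m) => _ /le_lt_trans; apply; apply: H2.
by apply: leqW; rewrite leq_maxr.
Qed.

End Isometry.

(** * Conditions A and B *)

Section Conditions.
Context {R : realType} {K : fieldType} {nrm : K -> R}.
Hypothesis Hn : ultranorm nrm.
Variable p : nat.
Hypothesis p_pr : prime p.
Hypothesis nrm_p : nrm p%:R = p%:R^-1.

Let lnp_gt0 : 0 < ln (p%:R : R). Proof. by rewrite ln_gt0 // ltr1n prime_gt1. Qed.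

(** Multiplying by ln p and by e clears the normalisation of the valuation and the division by d -
    1, leaving logarithms of absolute values. *)
Lemma vpr_gap (c y x : K) (m e : nat) : c != 0 -> y != 0 -> x != 0 -> (0 < e)%N ->
  (m%:R * vpr p nrm y + vpr p nrm x / e%:R - vpr p nrm c) * (ln p%:R * e%:R) =
  ln ((nrm c * (nrm y)^-1 ^+ m) ^+ e) - ln (nrm x).
Proof.
rewrite -!(unrm_gt0 Hn) => c0 y0 x0 e0.
rewrite lnXn ?mulr_gt0 ?exprn_gt0 ?invr_gt0 // lnM ?posrE ?exprn_gt0 ?invr_gt0 //.
rewrite lnXn ?invr_gt0 // lnV ?posrE // /vpr -[(_ + _) *+ e]mulr_natl -[(- _) *+ m]mulr_natl.
have e0' : e%:R != 0 :> R by rewrite pnatr_eq0 -lt0n.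
have := lnp_gt0; move: (ln p%:R) (ln (nrm c)) (ln (nrm y)) (ln (nrm x)) => L C Y X L0.
by move: e%:R m%:R e0' => E M E0; field; rewrite E0 gt_eqF.
Qed.

(** As the valuation of 0 is infinite, a finite upper bound also gives c != 0. *)
Lemma vp_lt (c y x : K) (m e : nat) : y != 0 -> x != 0 -> (0 < e)%N ->
  (vp p nrm c < (m%:R * vpr p nrm y + vpr p nrm x / e%:R)%:E)%E ->
  c != 0 /\ nrm x < (nrm c * (nrm y)^-1 ^+ m) ^+ e.
Proof.
move=> y0 x0 e0; rewrite /vp; case: eqVneq => // c0; rewrite lte_fin -subr_gt0 => H.
split=> //; have pos : 0 < ln p%:R * e%:R :> R by rewrite mulr_gt0 ?ltr0n.
have := mulr_gt0 H pos; rewrite vpr_gap // subr_gt0 ltr_ln ?posrE ?(unrm_gt0 Hn) //.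
by rewrite exprn_gt0 // mulr_gt0 ?exprn_gt0 ?invr_gt0 ?(unrm_gt0 Hn).
Qed.

Lemma lt_vp (c y x : K) (m e : nat) : c != 0 -> y != 0 -> x != 0 -> (0 < e)%N ->
  ((m%:R * vpr p nrm y + vpr p nrm x / e%:R)%:E < vp p nrm c)%E ->
  (nrm c * (nrm y)^-1 ^+ m) ^+ e < nrm x.
Proof.
move=> c0 y0 x0 e0; rewrite /vp (negPf c0) lte_fin -subr_lt0 => H.
have pos : 0 < ln p%:R * e%:R :> R by rewrite mulr_gt0 ?ltr0n.
have : (m%:R * vpr p nrm y + vpr p nrm x / e%:R - vpr p nrm c) * (ln p%:R * e%:R) < 0.
  by rewrite pmulr_llt0.
rewrite vpr_gap // subr_lt0 ltr_ln ?posrE ?(unrm_gt0 Hn) //.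
by rewrite exprn_gt0 // mulr_gt0 ?exprn_gt0 ?invr_gt0 ?(unrm_gt0 Hn).
Qed.

Variable q : R.
Hypotheses (q_gt1 : 1 < q) (q_p : q ^+ p.-1 = p%:R).

(* Multiplied by [q ^+ d.-1], the factorial in Conditions A and B turns into
   [1 / |d|], because of Legendre's bound [1 / |d!| <= q ^+ d.-1], which is an
   equality for powers of p. *)
Lemma cond_bounds (N d : nat) (c : K) (delta := (nrm d%:R)^-1) (beta := nrm c * delta * q) :
  (1 < d)%N -> condA p N d nrm c \/ condB p N d nrm c ->
  [/\ (p %| d)%N, c != 0, delta < (beta * delta ^+ N) ^+ d.-1
    & (0 < N)%N -> (beta * delta ^+ N.-1) ^+ d.-1 < delta].
Proof.
move=> d1 H; have d0 : (0 < d)%N by apply: ltnW.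
have q0 : 0 < q by apply: lt_trans q_gt1.
have K0 m : (0 < m)%N -> m%:R != 0 :> K := @unrm_natr_neq0 _ _ _ Hn _ p_pr nrm_p m.
have e0 : (0 < d.-1)%N by rewrite -ltnS prednK.
have x0 : ((d.-1)`!)%:R != 0 :> K by rewrite K0 ?fact_gt0.
have x1 : 0 < nrm ((d.-1)`!)%:R by rewrite (unrm_gt0 Hn).
have factE : (nrm (d`!)%:R)^-1 = delta / nrm ((d.-1)`!)%:R.
  by rewrite -[in LHS](prednK d0) factS prednK // natrM (unrmM Hn) invfM.
have [p_d up low] : [/\ (p %| d)%N,
    c != 0 /\ nrm ((d.-1)`!)%:R < (nrm c * delta ^+ N.+1) ^+ d.-1
    & (0 < N)%N -> (nrm c * delta ^+ N) ^+ d.-1 < nrm ((d.-1)`!)%:R /\ exists k, d = (p ^ k)%N].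
  case: H => [[-> p_d Hc]|[N1 [k dk] Hlow Hup]].
    (* Condition A is the upper bound of Condition B at N = 0, with the coefficient 1 suppressed. *)
    by split=> //; apply: (vp_lt (K0 _ d0) x0 e0); rewrite mul1r.
  have up := vp_lt (K0 _ d0) x0 e0 Hup; split=> // [|_].
    by rewrite dk dvdn_exp //; move: d1; rewrite dk; case: k {dk}.
  by split; [exact: lt_vp up.1 (K0 _ d0) x0 e0 Hlow | exists k].
case: up => c0 up.
have beta_e M : (beta * delta ^+ M) ^+ d.-1 = (nrm c * delta ^+ M.+1) ^+ d.-1 * q ^+ d.-1.
  by rewrite -exprMn /beta exprS; congr (_ ^+ _); ring.
split=> // [|N0].
  rewrite beta_e; apply: le_lt_trans (_ : nrm ((d.-1)`!)%:R * q ^+ d.-1 < _).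
    by rewrite mulrC -ler_pdivrMr // -factE (unrm_fact_le Hn p_pr nrm_p (ltW q_gt1) q_p).
  by rewrite ltr_pM2r // exprn_gt0.
have [{}low [k dk]] := low N0; rewrite beta_e prednK //.
apply: lt_le_trans (_ : nrm ((d.-1)`!)%:R * q ^+ d.-1 <= _).
  by rewrite ltr_pM2r // exprn_gt0.
by rewrite mulrC -ler_pdivlMr // -factE dk (unrm_fact_pexp Hn p_pr nrm_p q_p).
Qed.

End Conditions.

(** * Maximal disks of the two series, and the isometry *)

Unset Implicit Arguments.

Theorem theorem1p2 (R : realType) (K : closedFieldType) (nrm : K -> R)
    (p N d : nat) (c : K) (a a' : nat -> K) :
  prime p -> is_Cp p nrm -> (2 <= d)%N ->
  condA p N d nrm c \/ condB p N d nrm c ->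
  is_phi_seq d c a -> is_inverse_seq d a a' ->
  let rho := r_N p N d nrm c `^ ((d%:R)^-1) in
  [/\ 1 < r_N p N d nrm c,
      rad_pow nrm a = (r_N p N d nrm c)%:E,
      rad_pow nrm a' = (r_N p N d nrm c)%:E,
      (forall z, rho < nrm z ->
         (exists y, converges_to nrm (partial_phi d a z) y) /\
         (exists y, converges_to nrm (partial_phi d a' z) y))
    & forall f : K -> K,
        (forall z, rho < nrm z -> converges_to nrm (partial_phi d a z) (f z)) ->
        [/\ forall z, rho < nrm z -> rho < nrm (f z),
            forall z w, rho < nrm z -> rho < nrm w -> nrm (f z - f w) = nrm (z - w)
          & forall y, rho < nrm y -> exists2 z, rho < nrm z & f z = y]].
Proof.
move=> p_pr [n_ge0 [n_eq0 [n_M [n_D [nrm_p [complete _]]]]]] d1 cond a_phi inv_a rho.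
have Hn : ultranorm nrm by split.
have d0 : (0 < d)%N by apply: ltnW.
have p1 : 1 < p%:R :> R by rewrite ltr1n prime_gt1.
have p'0 : (0 < p.-1)%N by rewrite -ltnS prednK ?prime_gt0 ?prime_gt1.
pose q : R := p%:R `^ (p.-1%:R)^-1.
have q_p : q ^+ p.-1 = p%:R by apply: powR_root; rewrite ?ler0n.
have q_gt1 : 1 < q.
  rewrite ltNge; apply/negP => q1; have := exprn_ile1 p.-1 (powR_ge0 _ _) q1.
  by rewrite q_p leNgt p1.
have q0 : 0 < q by apply: lt_trans q_gt1.
have [p_d c0 up low] := cond_bounds Hn p_pr nrm_p q_gt1 q_p d1 cond.
set delta := (nrm d%:R)^-1 in up low; set beta := nrm c * delta * q in up low.
have BE i : nrm c / nrm (d ^ i.+1)%:R * q = beta * delta ^+ i.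
  by rewrite natrX (unrmX Hn) -exprVn -/delta exprS /beta; ring.
have d_neq0 : d%:R != 0 :> K := unrm_natr_neq0 Hn p_pr nrm_p d0.
have delta_p : p%:R <= delta.
  rewrite -[p%:R]invrK lef_pV2 ?posrE ?invr_gt0 ?(unrm_gt0 Hn) ?(lt_trans _ p1) //.
  exact: unrm_nat_dvd.
have delta1 : 1 < delta by apply: lt_le_trans delta_p.
have beta0 : 0 < beta by rewrite !mulr_gt0 ?invr_gt0 ?(unrm_gt0 Hn).
set r := r_N p N d nrm c.
have dN0 : (0 < d ^ N)%N by rewrite expn_gt0 d0.
have r_B : r ^+ (d ^ N) = nrm c / nrm (d ^ N.+1)%:R * q.
  rewrite /r /r_N powR_root ?(unrmM Hn) ?(unrmV Hn) //.
  by rewrite !mulr_ge0 ?invr_ge0 ?(unrm_ge0 Hn) ?(ltW q0).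
have r_B' := r_B; rewrite BE in r_B'.
have B0 : 0 <= beta * delta ^+ N.
  by rewrite mulr_ge0 ?exprn_ge0 ?(ltW beta0) ?(ltW (lt_trans ltr01 delta1)).
(* Otherwise B_N <= 1, against 1 < delta < B_N^(d-1). *)
have r1 : 1 < r.
  rewrite ltNge; apply/negP => le_r1.
  have B1 : beta * delta ^+ N <= 1 by rewrite -r_B' exprn_ile1 // powR_ge0.
  have := lt_trans delta1 up; rewrite ltNge => /negP; apply.
  exact: exprn_ile1.
have r0 : 0 < r by apply: lt_trans r1.
(* The chain is q <= q^(p-1) = p <= delta < B_N^(d-1). *)
have q_B : q < (nrm c / nrm (d ^ N.+1)%:R * q) ^+ d.-1.
  rewrite BE; apply: le_lt_trans up; apply: le_trans delta_p; rewrite -q_p.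
  by rewrite -[X in X <= _]expr1 ler_weXn2l // ltW.
have [theta [theta1 theta_r theta_B r_theta]] := theta_exists d1 beta0 delta1 r1 r_B' up low.
have theta_B' i : i != N -> nrm c / nrm (d ^ i.+1)%:R * q <= theta ^+ (d ^ i).
  by rewrite BE; apply: theta_B.
have a_gap := ser1_gap Hn p_pr nrm_p q_gt1 q_p d1 p_d a_phi r_B theta1 theta_r theta_B'.
have a_le := ser1_le Hn p_pr nrm_p q_gt1 q_p d1 p_d a_phi r_B theta1 theta_r theta_B'.
have a_growth := ser1_growth Hn p_pr nrm_p q_gt1 q_p d1 p_d a_phi r_B theta1 theta_r theta_B'
  r_theta q_B.
set eta := growth_gap q r theta in a_gap.
have eta0 : 0 < eta by apply: growth_gap_gt0.
have eta1 : eta < 1 by apply: growth_gap_lt1.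
have Hr : weight (fun i => r ^+ i) by apply/weight_exp/ltW.
have Heta : weight (eta_weight eta r) by apply: weight_eta; rewrite ?ltW.
have a'_gap := inverse_le Hn Heta inv_a a_gap.
have a'_le := inverse_le Hn Hr inv_a a_le.
have a_sharp s : 0 < s -> s < r -> ~ (forall n, nrm (ser1 a n) <= s ^+ n).
  (* [ser1_growth] requires a radius of at least theta. With C = 1 it gives r^M <= q s'^M for every
     M = d^N p^t, impossible for large t. *)
  move=> s0 sr Hs; pose s' := Num.max s theta.
  have s'0 : 0 < s' by rewrite lt_max s0.
  have s'r : s' < r by rewrite gt_max sr.
  have [n0 /(_ (d ^ N * p ^ n0)%N)] := exp_dominates q s'0 s'r.
  have -> : (n0 <= d ^ N * p ^ n0)%N.
    by rewrite (leq_trans (ltnW (ltn_expl n0 (prime_gt1 p_pr)))) // leq_pmull.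
  move/(_ isT); rewrite ltNge => /negP; apply; rewrite -ler_pdivrMl //.
  rewrite -[X in _ <= X]mul1r; apply: a_growth => [|n]; first by rewrite le_max lexx orbT.
  rewrite mul1r; apply: le_trans (Hs n) _.
  by rewrite lerXn2r ?nnegrE ?(ltW s0) ?(ltW s'0) // le_max lexx.
have rhoE z : (rho < nrm z) = (r < nrm z ^+ d).
  have rho_r : rho ^+ d = r by apply: powR_root; rewrite // ltW.
  by rewrite -rho_r ltr_pXn2r ?nnegrE ?(unrm_ge0 Hn) // powR_ge0.
split=> //.
- apply: (rad_powE Hn r0 a_le) => s n0 s0 sr Hs.
  have [s' /andP [ss' s'r]] := radius_shrink Hn eta0 eta1 a_gap s0 sr Hs.
  by apply: a_sharp s'r; apply: lt_le_trans ss'.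
(* A smaller radius for the inverse series would pass back to F through [inverse_ge]. *)
- apply: (rad_powE Hn r0 a'_le) => s n0 s0 sr Hs.
  have [s' /andP [ss' s'r] Hs'] := radius_shrink Hn eta0 eta1 a'_gap s0 sr Hs.
  have s'0 : 0 < s' by apply: lt_le_trans ss'.
  have Ha := inverse_ge Hn (weight_exp (ltW s'0)) inv_a Hs'.
  exact: a_sharp s'0 s'r Ha.
- move=> z; rewrite rhoE => Hz.
  by split; [exact: partial_phi_cvg a_le _ Hz | exact: partial_phi_cvg a'_le _ Hz].
move=> f Hf; have f_lim z : r < nrm z ^+ d -> converges_to nrm (partial_phi d a z) (f z).
  by rewrite -rhoE; apply: Hf.
split=> [z|z w|y]; rewrite !rhoE.
- by move=> Hz; rewrite (phi_norm Hn d0 r0 a_le f_lim).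
- by move=> Hz Hw; apply: (phi_isometry Hn d0 r0 a_le f_lim).
move=> Hy; have [z Hz fz] := phi_surjective Hn complete d0 r0 a_le f_lim Hy.
by exists z; rewrite ?rhoE.
Qed.
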